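(* Let $X$ be a compact geodesic space. Then $X$ has a universal cover if and only if $\bar{\pi}_1^{\mathcal{C}}(X)$ is discrete, and $X$ has a simply connected cover if and only if $\pi_1^{\mathcal{C}}(X)$ is discrete.
   Context: A geodesic space is a metric space in which any two points are joined by a curve whose length equals the distance between them. A cover of $X$ is a connected covering space in the traditional sense. A universal cover of $X$ is a cover $f:Y\to X$ such that for any cover $g:Z\to X$ there is a cover $h:Y\to Z$ with $g\circ h=f$ (not necessarily simply connected). Let $X$ be a geodesic space with base point $*$ (immaterial up to isomorphism). For $\varepsilon>0$, an $\varepsilon$-chain is a finite sequence $\{x_0,\dots,x_n\}$ in $X$ with $d(x_{i-1},x_i)<\varepsilon$ for all $i$. A basic move adds or removes one point, keeping the endpoints fixed and keeping the result an $\varepsilon$-chain; two $\varepsilon$-chains are $\varepsilon$-homotopic if connected by finitely many basic moves. $\pi_\varepsilon(X)$ is the group, under concatenation, of $\varepsilon$-homotopy classes of $\varepsilon$-chains that start and end at $*$. A strong $\varepsilon$-chain along a path $\gamma:[a,b]\to X$ is an $\varepsilon$-chain $\{\gamma(t_0),\dots,\gamma(t_n)\}$ for a partition $a=t_0<\dots<t_n=b$ with $\gamma([t_{i-1},t_i])\subset B_\varepsilon(\gamma(t_{i-1}))\cap B_\varepsilon(\gamma(t_i))$ for each $i$. The well-defined surjective homomorphism $h_\varepsilon:\pi_1(X)\to\pi_\varepsilon(X)$ sends $[\gamma]$ to the class of any strong $\varepsilon$-chain along $\gamma$. Put $K_\varepsilon=\ker h_\varepsilon$ (these are nested: $K_\delta\subseteq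 K_\varepsilon$ for $\delta<\varepsilon$), $\pi_{cl}(X)=\bigcap_{\varepsilon>0}K_\varepsilon$. $\pi_1^{\mathcal{C}}(X)$ is $\pi_1(X)$ with the covering topology, i.e. the topology having as basis all cosets $gK_\varepsilon$, $g\in\pi_1(X)$, $\varepsilon>0$. $\bar{\pi}_1^{\mathcal{C}}(X)=\pi_1^{\mathcal{C}}(X)/\pi_{cl}(X)$ with the quotient topology. *)

(* Defs.v *)
From HB Require Import structures.
From Stdlib Require Import Relations.Relation_Operators.
From mathcomp Require Import all_boot all_order all_algebra.
From mathcomp Require Import generic_quotient.
From mathcomp Require Import boolp classical_sets functions reals ereal.
From mathcomp Require Import topology normedtype numfun continuous_path.
From mathcomp Require Import ring lra.

Set Implicit Arguments.
Unset Strict Implicit.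
Unset Printing Implicit Defensive.

Import Order.TTheory GRing.Theory Num.Theory.
Import numFieldNormedType.Exports.

Local Open Scope classical_set_scope.
Local Open Scope ring_scope.
Local Open Scope quotient_scope.

(* A map out of [unit_itv R] is carried by a function on all of [R], but its
   continuity only involves its values on [0, 1]; what it does outside [0, 1]
   is irrelevant, and is forgotten by [homotopic]. *)
Section unit_itv.
Variable R : realType.

Definition unit_itv : Type := subspace `[0 : R, 1].

HB.instance Definition _ := Topological.on unit_itv.

Lemma unit_itv_neq : (0 : R) != 1. Proof. by rewrite eq_sym oner_neq0. Qed.

HB.instance Definition _ :=
  @isBiPointed.Build unit_itv (0 : R) (1 : R) unit_itv_neq.
End unit_itv.

Section continuity.

Lemma continuous_comp_within (S T U : topologicalType) (A : set T) (f : T -> U)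
    (c : S -> T) :
  {within A, continuous f} -> continuous c -> (forall s, A (c s)) ->
  continuous (fun s => f (c s)).
Proof.
move=> /subspace_continuousP fc cc cA s; move=> W /(fc _ (cA s)) /= /cc.
by rewrite /nbhs /=; apply: filterS => z /=; apply; exact: cA.
Qed.

Lemma continuous_glue (R : realType) (S T : topologicalType) (u v : S -> T)
    (p : S -> R) :
  continuous u -> continuous v -> continuous p ->
  (forall z, p z = 0 -> u z = v z) ->
  continuous (fun z => if p z <= 0 then u z else v z).
Proof.
move=> cu cv cp uv z; have [pz|pz|pz] := ltrgtP (p z) 0.
- move=> W /=; rewrite (ltW pz) => /(cu z) uW; rewrite /nbhs /=.
  near=> y; rewrite /= ifT; first by near: y; exact: uW.
  by apply: ltW; near: y; exact: (cvgr_lt (p z) (cp z) _ pz).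
- move=> W /=; rewrite leNgt pz /= => /(cv z) vW; rewrite /nbhs /=.
  near=> y; rewrite /= ifF; first by near: y; exact: vW.
  rewrite leNgt; apply/negbF; near: y; exact: (cvgr_gt (p z) (cp z) _ pz).
- move=> W /=; rewrite pz lexx => uW; rewrite /nbhs /=.
  have vW : nbhs (v z) W by rewrite -uv.
  by near=> y; rewrite /=; case: (p y <= 0); near: y; [exact: cu|exact: cv].
Unshelve. all: by end_near. Qed.

Lemma compact_unif_continuous (R : realType) (T X : pseudoMetricType R)
    (f : T -> X) (K : set T) : compact K -> continuous f ->
  forall e : R, 0 < e -> exists2 d : R, 0 < d &
    forall t t', K t -> ball t d t' -> ball (f t) e (f t').
Proof.
move=> /compact_near_coveringP cK cf e e0.
have : \forall d \near 0^'+, K `<=` [set t | forall t', ball t d t' ->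
    ball (f t) e (f t')].
  apply: (cK R _ (fun d t => forall t', ball t d t' -> ball (f t) e (f t'))).
  move=> x _; have e2 : 0 < e / 2 by rewrite divr_gt0.
  have /nbhs_ballP[r /= r0 rf] := cf x _ (nbhsx_ballx (f x) _ e2).
  have r2 : 0 < r / 2 by rewrite divr_gt0.
  near=> y d.
  have xy : ball x (r / 2) y by near: y; exact: nbhsx_ballx.
  have dr : d < r / 2 by near: d; exact: nbhs_right_lt.
  move=> t' ytd /=; rewrite (splitr e).
  apply: (@ball_triangle _ _ (f x)).
    by apply/ball_sym/rf; apply: le_ball xy; rewrite ler_pdivrMr //; lra.
  apply: rf; rewrite /= (splitr r); apply: (ball_triangle xy).
  exact: le_ball (ltW dr) _ ytd.
case/(filterI (nbhs_right_gt (0 : R)))/filter_ex => d [/= d0 dK].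
by exists d => // t t' /dK; exact.
Unshelve. all: by end_near. Qed.

End continuity.

Section continuous_combinators.
Context {R : realType} {S T U : topologicalType}.

Lemma continuous_compf (g : T -> U) (f : S -> T) :
  continuous g -> continuous f -> continuous (fun s => g (f s)).
Proof. by move=> cg cf s; apply: continuous_comp; [exact: cf|exact: cg]. Qed.

Lemma continuous_pairf (f : S -> T) (g : S -> U) :
  continuous f -> continuous g -> continuous (fun s => (f s, g s)).
Proof. by move=> cf cg s; apply: cvg_pair; [exact: cf|exact: cg]. Qed.

Lemma continuous_cstf (t : T) : continuous (fun _ : S => t).
Proof. by move=> s; exact: cvg_cst. Qed.

Lemma continuous_subf (f g : S -> R) :
  continuous f -> continuous g -> continuous (fun s => f s - g s).
Proof. by move=> cf cg s; apply: cvgB; [exact: cf|exact: cg]. Qed.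

Lemma continuous_addf (f g : S -> R) :
  continuous f -> continuous g -> continuous (fun s => f s + g s).
Proof. by move=> cf cg s; apply: cvgD; [exact: cf|exact: cg]. Qed.

Lemma continuous_mulf (f g : S -> R) :
  continuous f -> continuous g -> continuous (fun s => f s * g s).
Proof. by move=> cf cg s; apply: cvgM; [exact: cf|exact: cg]. Qed.

Lemma continuous_maxf (f g : S -> R) :
  continuous f -> continuous g -> continuous (fun s => Num.max (f s) (g s)).
Proof. exact: max_fun_continuous. Qed.

Lemma continuous_minf (f g : S -> R) :
  continuous f -> continuous g -> continuous (fun s => Num.min (f s) (g s)).
Proof. exact: min_fun_continuous. Qed.
End continuous_combinators.

Lemma continuous_idf (S : topologicalType) : continuous (fun s : S => s).
Proof. by move=> s; exact: cvg_id. Qed.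

Lemma continuous_fstf (S T : topologicalType) : continuous (fun s : S * T => s.1).
Proof. by move=> s; exact: cvg_fst. Qed.

Lemma continuous_sndf (S T : topologicalType) : continuous (fun s : S * T => s.2).
Proof. by move=> s; exact: cvg_snd. Qed.


Section clamp.
Variable R : realType.

Definition clamp (t : R) : R := Num.max 0 (Num.min 1 t).

Lemma clamp_itv t : clamp t \in `[0, 1].
Proof. by rewrite in_itv /= /clamp le_max lexx ge_max ler01 ge_min lexx. Qed.

Lemma clampE t : t \in `[0, 1] -> clamp t = t.
Proof.
rewrite in_itv /= => /andP[t0 t1]; rewrite /clamp.
by case: (ltrP 1 t) => ?; case: ltrP => ?; lra.
Qed.

Lemma clamp_continuous : continuous clamp.
Proof.
by apply: continuous_maxf; [exact: continuous_cstf|apply: continuous_minf; [exact: continuous_cstf|exact: continuous_idf]].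
Qed.

Lemma continuous_clampf (S : topologicalType) (f : S -> R) :
  continuous f -> continuous (fun s => clamp (f s)).
Proof. exact/continuous_compf/clamp_continuous. Qed.

End clamp.

Section homotopy.
Context {R : realType} {T : topologicalType} {x y : T}.
Local Notation I := (unit_itv R).
Local Notation unit_square := (`[0 : R, 1] `*` `[0 : R, 1]).

Definition homotopic (f g : {path I from x to y in T}) : Prop :=
  exists H : R * R -> T,
  [/\ {within unit_square, continuous H},
      forall t, t \in `[0, 1] -> H (t, 0) = f t,
      forall t, t \in `[0, 1] -> H (t, 1) = g t &
      forall s, s \in `[0, 1] -> H (0, s) = x /\ H (1, s) = y].

Lemma path_clamp_continuous (f : {path I from x to y in T}) :
  continuous (fun t : R => f (clamp t)).
Proof.
apply: (@continuous_comp_within R R T [set` `[0 : R, 1]] f (@clamp R)).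
- exact: (@cts_fun I T f).
- exact: clamp_continuous.
- exact: clamp_itv.
Qed.

Lemma homotopicP (f g : {path I from x to y in T}) :
  homotopic f g <-> exists H : R * R -> T,
  [/\ continuous H,
      forall t, t \in `[0, 1] -> H (t, 0) = f t,
      forall t, t \in `[0, 1] -> H (t, 1) = g t &
      forall s, s \in `[0, 1] -> H (0, s) = x /\ H (1, s) = y].
Proof.
split=> [] [H [cH H0 H1 Hs]]; last first.
  by exists H; split=> //; exact: continuous_subspaceT.
have c01 : clamp 0 = 0 :> R /\ clamp 1 = 1 :> R.
  by split; rewrite clampE // in_itv /= ?lexx ?ler01.
exists (fun p => H (clamp p.1, clamp p.2)); split.
- apply: (continuous_comp_within cH).
    by apply: continuous_pairf; apply: continuous_clampf; [exact: continuous_fstf|exact: continuous_sndf].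
  by move=> p; split; exact: clamp_itv.
- by move=> t t01 /=; rewrite c01.1 clampE // H0.
- by move=> t t01 /=; rewrite c01.2 clampE // H1.
- by move=> s s01 /=; rewrite c01.1 c01.2 clampE //; exact: Hs.
Qed.

Lemma homotopic_refl f : homotopic f f.
Proof.
apply/homotopicP; exists (fun p => f (clamp p.1)); split=> [|t t01|t t01|s s01] /=.
- by apply: (continuous_compf (@path_clamp_continuous f)); exact: continuous_fstf.
- by rewrite clampE.
- by rewrite clampE.
- by rewrite !clampE ?in_itv /= ?lexx ?ler01 //; split; [exact: (@path_zero I)|exact: (@path_one I)].
Qed.

Lemma homotopic_sym f g : homotopic f g -> homotopic g f.
Proof.
move=> /homotopicP[H [cH H0 H1 Hs]].
apply/homotopicP; exists (fun p => H (p.1, 1 - p.2)); split=> [|t t01|t t01|s s01] /=.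
- apply: (continuous_compf cH); apply: continuous_pairf; first exact: continuous_fstf.
  by apply: continuous_subf; [exact: continuous_cstf|exact: continuous_sndf].
- by rewrite subr0 H1.
- by rewrite subrr H0.
- by apply: Hs; move: s01; rewrite !in_itv /=; lra.
Qed.

Lemma homotopic_trans f g h : homotopic f g -> homotopic g h -> homotopic f h.
Proof.
move=> /homotopicP[H [cH H0 H1 Hs]] /homotopicP[K [cK K0 K1 Ks]].
apply/homotopicP.
exists (fun p => if p.2 - 2^-1 <= 0 then H (clamp p.1, 2 * p.2)
                 else K (clamp p.1, 2 * p.2 - 1)); split=> [|t t01|t t01|s].
- apply: continuous_glue => [|||p /eqP].
  + apply: (continuous_compf cH); apply: continuous_pairf; first by apply: continuous_clampf; exact: continuous_fstf.
    by apply: continuous_mulf; [exact: continuous_cstf|exact: continuous_sndf].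
  + apply: (continuous_compf cK); apply: continuous_pairf; first by apply: continuous_clampf; exact: continuous_fstf.
    by apply: continuous_subf; [apply: continuous_mulf; [exact: continuous_cstf|exact: continuous_sndf]|exact: continuous_cstf].
  + by apply: continuous_subf; [exact: continuous_sndf|exact: continuous_cstf].
  + rewrite subr_eq0 => /eqP ->; rewrite mulfV // subrr.
    by rewrite H1 ?K0 //; exact: clamp_itv.
- by rewrite /= clampE // mulr0 ifT ?H0 //; lra.
- by rewrite /= clampE // mulr1 ifF; [rewrite (_ : 2 - 1 = 1) ?K1 //; ring | apply/negbTE; rewrite -ltNge; lra].
- rewrite in_itv /= => /andP[s0 s1].
  rewrite !clampE ?in_itv /= ?lexx ?ler01 //.
  by case: lerP => s2; [apply: Hs|apply: Ks]; rewrite in_itv /=; lra.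
Qed.

Let homotopicb (f g : {path I from x to y in T}) := `[< homotopic f g >].

Let homotopicb_refl : reflexive homotopicb.
Proof. by move=> f; apply/asboolP; exact: homotopic_refl. Qed.

Let homotopicb_sym : symmetric homotopicb.
Proof. by move=> f g; apply/asboolP/asboolP; exact: homotopic_sym. Qed.

Let homotopicb_trans : transitive homotopicb.
Proof.
move=> g f h /asboolP fg /asboolP gh; apply/asboolP.
exact: homotopic_trans fg gh.
Qed.

Definition homotopic_equiv :=
  EquivRel homotopicb homotopicb_refl homotopicb_sym homotopicb_trans.
End homotopy.

Section path_operations.
Context {R : realType} {T : topologicalType}.
Local Notation I := (unit_itv R).
Local Notation path x y := {path I from x to y in T}.

Lemma within_clamp_continuous (f : R -> T) :
  continuous (fun t => f (clamp t)) -> continuous (f : I -> T).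
Proof.
move=> cf; apply: (subspace_eq_continuous (f := fun t => f (clamp t))).
  by move=> t; rewrite inE /= => t01; rewrite clampE.
exact: (@continuous_subspaceT R T [set` `[0 : R, 1]] _ cf).
Qed.

Lemma clamp0 : clamp 0 = 0 :> R.
Proof. by rewrite clampE // in_itv /= lexx ler01. Qed.

Lemma clamp1 : clamp 1 = 1 :> R.
Proof. by rewrite clampE // in_itv /= lexx ler01. Qed.

Lemma path0 x y (f : path x y) : f (0 : R) = x. Proof. exact: (@path_zero I). Qed.

Lemma path1 x y (f : path x y) : f (1 : R) = y. Proof. exact: (@path_one I). Qed.

Definition concat_fun (f g : R -> T) (t : R) : T :=
  if t <= 2^-1 then f (2 * t) else g (2 * t - 1).

Section concat.
Context {x y z : T} (f : path x y) (g : path y z).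

Lemma concat_continuous : continuous (concat_fun f g : I -> T).
Proof.
apply: within_clamp_continuous.
rewrite (_ : (fun _ => _) = fun t => if clamp t - 2^-1 <= 0
    then f (clamp (2 * clamp t)) else g (clamp (2 * clamp t - 1))).
  have cc : continuous (fun t : R => clamp t) by exact: clamp_continuous.
  have c2 : continuous (fun t : R => 2 * clamp t) by apply: continuous_mulf; [exact: continuous_cstf|].
  apply: continuous_glue => [|||t /eqP].
  - exact: (continuous_compf (@path_clamp_continuous _ _ _ _ f) c2).
  - apply: (continuous_compf (@path_clamp_continuous _ _ _ _ g)).
    by apply: continuous_subf; [|exact: continuous_cstf].
  - by apply: continuous_subf; [|exact: continuous_cstf].
  - by rewrite subr_eq0 => /eqP ->; rewrite mulfV // subrr clamp0 clamp1 path0 path1.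
apply/funext => t; rewrite /concat_fun subr_le0; have := clamp_itv t.
rewrite in_itv /= => /andP[c0 c1].
case: lerP => ct.
  by rewrite (@clampE _ (2 * _)) // in_itv /=; lra.
by rewrite (@clampE _ (2 * _ - 1)) // in_itv /=; lra.
Qed.

Lemma concat0 : concat_fun f g (0 : R) = x.
Proof. by rewrite /concat_fun ifT ?mulr0 ?path0 //; lra. Qed.

Lemma concat1 : concat_fun f g (1 : R) = z.
Proof.
rewrite /concat_fun ifF; last by apply/negbTE; rewrite -ltNge; lra.
by rewrite (_ : 2 * 1 - 1 = 1) ?path1 //; ring.
Qed.

Definition path_concat : path x z := mk_path concat_continuous concat0 concat1.

Lemma path_concatE t : path_concat t = concat_fun f g t. Proof. by []. Qed.
End concat.

Section inverse.
Context {x y : T} (f : path x y).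

Lemma inv_continuous : continuous ((fun t : R => f (1 - t)) : I -> T).
Proof.
apply: within_clamp_continuous.
rewrite (_ : (fun _ => _) = fun t => f (clamp (1 - clamp t))).
  apply: (continuous_compf (@path_clamp_continuous _ _ _ _ f)).
  by apply: continuous_subf; [exact: continuous_cstf|exact: clamp_continuous].
apply/funext => t; rewrite (@clampE _ (1 - _)) //; have := clamp_itv t.
by rewrite !in_itv /=; lra.
Qed.

Lemma inv0 : f (1 - 0 : R) = y. Proof. by rewrite subr0 path1. Qed.

Lemma inv1 : f (1 - 1 : R) = x. Proof. by rewrite subrr path0. Qed.

Definition path_inv : path y x := mk_path inv_continuous inv0 inv1.

Lemma path_invE t : path_inv t = f (1 - t). Proof. by []. Qed.
End inverse.

Lemma homotopic_concat x y z (f f' : path x y) (g g' : path y z) :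
  homotopic f f' -> homotopic g g' ->
  homotopic (path_concat f g) (path_concat f' g').
Proof.
move=> /homotopicP[H [cH H0 H1 Hs]] /homotopicP[K [cK K0 K1 Ks]].
apply/homotopicP.
exists (fun p => if p.1 - 2^-1 <= 0 then H (2 * p.1, clamp p.2)
                 else K (2 * p.1 - 1, clamp p.2)).
split=> [|t t01|t t01|s].
- have c2 : continuous (fun p : R * R => clamp p.2) by apply: continuous_clampf; exact: continuous_sndf.
  have c1 : continuous (fun p : R * R => 2 * p.1).
    by apply: continuous_mulf; [exact: continuous_cstf|exact: continuous_fstf].
  apply: continuous_glue => [|||p /eqP].
  + by apply: (continuous_compf cH); apply: continuous_pairf.
  + by apply: (continuous_compf cK); apply: continuous_pairf => //; apply: continuous_subf => //; exact: continuous_cstf.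
  + by apply: continuous_subf; [exact: continuous_fstf|exact: continuous_cstf].
  + rewrite subr_eq0 => /eqP ->; rewrite mulfV // subrr.
    by rewrite (Hs _ (clamp_itv _)).2 (Ks _ (clamp_itv _)).1.
- rewrite path_concatE /concat_fun /= clamp0 subr_le0; move: t01; rewrite in_itv /=.
  move=> /andP[t0 t1]; case: lerP => t2.
    by rewrite H0 // in_itv /=; lra.
  by rewrite K0 // in_itv /=; lra.
- rewrite path_concatE /concat_fun /= clamp1 subr_le0; move: t01; rewrite in_itv /=.
  move=> /andP[t0 t1]; case: lerP => t2.
    by rewrite H1 // in_itv /=; lra.
  by rewrite K1 // in_itv /=; lra.
- move=> s01 /=; rewrite clampE // ifT; last by lra.
  rewrite ifF; last by apply/negbTE; rewrite -ltNge; lra.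
  rewrite mulr0 (_ : 2 * 1 - 1 = 1); last by ring.
  by rewrite (Hs _ s01).1 (Ks _ s01).2.
Qed.

Lemma homotopic_inv x y (f g : path x y) :
  homotopic f g -> homotopic (path_inv f) (path_inv g).
Proof.
move=> /homotopicP[H [cH H0 H1 Hs]].
apply/homotopicP; exists (fun p => H (1 - p.1, p.2)); split=> [|t t01|t t01|s s01] /=.
- apply: (continuous_compf cH); apply: continuous_pairf; last exact: continuous_sndf.
  by apply: continuous_subf; [exact: continuous_cstf|exact: continuous_fstf].
- by rewrite H0 //; move: t01; rewrite !in_itv /=; lra.
- by rewrite H1 //; move: t01; rewrite !in_itv /=; lra.
- by rewrite subr0 subrr; have [-> ->] := Hs _ s01.
Qed.

Lemma homotopic_reparam x y a b (f : path a b) (p0 p1 : path x y)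
    (u0 u1 : R -> R) :
  continuous u0 -> continuous u1 -> u0 0 = u1 0 -> u0 1 = u1 1 ->
  (forall t, t \in `[0, 1] -> p0 t = f (clamp (u0 t))) ->
  (forall t, t \in `[0, 1] -> p1 t = f (clamp (u1 t))) ->
  homotopic p0 p1.
Proof.
move=> c0 c1 e0 e1 P0 P1; apply/homotopicP.
exists (fun p => f (clamp ((1 - p.2) * u0 p.1 + p.2 * u1 p.1))).
split=> [|t t01|t t01|s s01] /=.
- apply: (continuous_compf (@path_clamp_continuous _ _ _ _ f)); apply: continuous_addf; apply: continuous_mulf.
  + by apply: continuous_subf; [exact: continuous_cstf|exact: continuous_sndf].
  + by apply: (continuous_compf c0); exact: continuous_fstf.
  + exact: continuous_sndf.
  + by apply: (continuous_compf c1); exact: continuous_fstf.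
- by rewrite P0 // subr0 mul1r mul0r addr0.
- by rewrite P1 // subrr mul1r mul0r add0r.
- rewrite -e0 -e1 -!mulrDl subrK !mul1r -!P0 ?path0 ?path1 //.
  all: by rewrite in_itv /= ?lexx ler01.
Qed.

Lemma concatA x y z w (f : path x y) (g : path y z) (h : path z w) :
  homotopic (path_concat f (path_concat g h)) (path_concat (path_concat f g) h).
Proof.
pose u (t : R) := Num.max (Num.max (t / 2) (t - 4^-1)) (2 * t - 1).
apply: (@homotopic_reparam _ _ _ _ (path_concat (path_concat f g) h) _ _ u id).
- apply: continuous_maxf; first apply: continuous_maxf.
  + by apply: continuous_mulf; [exact: continuous_idf|exact: continuous_cstf].
  + by apply: continuous_subf; [exact: continuous_idf|exact: continuous_cstf].
  + by apply: continuous_subf; [apply: continuous_mulf; [exact: continuous_cstf|exact: continuous_idf]|exact: continuous_cstf].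
- exact: continuous_idf.
- by rewrite /u !maxEle; do 2 case: ifP; lra.
- by rewrite /u !maxEle; do 2 case: ifP; lra.
- move=> t; rewrite in_itv /= => /andP[t0 t1].
  have [t2|t2] := lerP t 2^-1; last have [t3|t3] := lerP t (3 / 4).
  + have ut : u t = t / 2 by rewrite /u !maxEle; do 2 case: ifP; lra.
    rewrite ut clampE; last by rewrite in_itv /=; lra.
    rewrite !path_concatE /concat_fun t2 !path_concatE /concat_fun.
    by rewrite ifT ?ifT; [congr (f _) | |]; lra.
  + have ut : u t = t - 4^-1 by rewrite /u !maxEle; do 2 case: ifP; lra.
    rewrite ut clampE; last by rewrite in_itv /=; lra.
    rewrite !path_concatE /concat_fun !path_concatE /concat_fun.
    rewrite [LHS]ifF; last by apply/negbTE; rewrite -ltNge; lra.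
    rewrite [LHS]ifT; last by lra.
    rewrite [RHS]ifT; last by lra.
    rewrite [RHS]ifF; last by apply/negbTE; rewrite -ltNge; lra.
    by congr (g _); lra.
  + have ut : u t = 2 * t - 1 by rewrite /u !maxEle; do 2 case: ifP; lra.
    rewrite ut clampE; last by rewrite in_itv /=; lra.
    rewrite !path_concatE /concat_fun !path_concatE /concat_fun.
    rewrite [LHS]ifF; last by apply/negbTE; rewrite -ltNge; lra.
    rewrite [LHS]ifF; last by apply/negbTE; rewrite -ltNge; lra.
    rewrite [RHS]ifF; last by apply/negbTE; rewrite -ltNge; lra.
    by congr (h _); lra.
- by move=> t t01; rewrite clampE.
Qed.

Lemma concat1p x y (f : path x y) : homotopic (path_concat (cst x) f) f.
Proof.
apply: (@homotopic_reparam _ _ _ _ f _ _ (fun t => Num.max 0 (2 * t - 1)) id).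
- apply: continuous_maxf; first exact: continuous_cstf.
  by apply: continuous_subf; [apply: continuous_mulf; [exact: continuous_cstf|exact: continuous_idf]|exact: continuous_cstf].
- exact: continuous_idf.
- by rewrite maxEle; case: ifP; lra.
- by rewrite maxEle; case: ifP; lra.
- move=> t; rewrite in_itv /= => /andP[t0 t1].
  rewrite path_concatE /concat_fun clampE; last first.
    by rewrite in_itv /= maxEle; case: ifP; lra.
  rewrite maxEle; case: (lerP t) => t2.
    by rewrite (_ : (if _ then _ else _) = 0) ?path0 //; case: ifP; lra.
  by rewrite ifT //; lra.
- by move=> t t01; rewrite clampE.
Qed.

Lemma concatp1 x y (f : path x y) : homotopic (path_concat f (cst y)) f.
Proof.
apply: (@homotopic_reparam _ _ _ _ f _ _ (fun t => Num.min 1 (2 * t)) id).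
- apply: continuous_minf; first exact: continuous_cstf.
  by apply: continuous_mulf; [exact: continuous_cstf|exact: continuous_idf].
- exact: continuous_idf.
- by rewrite minEle; case: ifP; lra.
- by rewrite minEle; case: ifP; lra.
- move=> t; rewrite in_itv /= => /andP[t0 t1].
  rewrite path_concatE /concat_fun clampE; last first.
    by rewrite in_itv /= minEle; case: ifP; lra.
  rewrite minEle; case: (lerP t) => t2.
    by congr (f _); case: ifP; lra.
  by rewrite ifT ?path1 //; lra.
- by move=> t t01; rewrite clampE.
Qed.

Lemma concatpV x y (f : path x y) :
  homotopic (path_concat f (path_inv f)) (cst x).
Proof.
apply: (@homotopic_reparam _ _ _ _ f _ _
  (fun t => Num.min (2 * t) (2 - 2 * t)) (fun=> 0)).
- apply: continuous_minf; first by apply: continuous_mulf; [exact: continuous_cstf|exact: continuous_idf].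
  by apply: continuous_subf; [exact: continuous_cstf|apply: continuous_mulf; [exact: continuous_cstf|exact: continuous_idf]].
- exact: continuous_cstf.
- by rewrite minEle; case: ifP; lra.
- by rewrite minEle; case: ifP; lra.
- move=> t; rewrite in_itv /= => /andP[t0 t1].
  rewrite path_concatE /concat_fun clampE; last first.
    by rewrite in_itv /= minEle; case: ifP; lra.
  by rewrite path_invE minEle; case: (lerP t) => t2; congr (f _); case: ifP; lra.
- by move=> t t01; rewrite clamp0 path0.
Qed.

Lemma concatVp x y (f : path x y) :
  homotopic (path_concat (path_inv f) f) (cst y).
Proof.
have /homotopicP[H [cH H0 H1 Hs]] := concatpV (path_inv f).
apply/homotopicP; exists H; split=> // t t01; rewrite H0 //.
rewrite !path_concatE /concat_fun; case: ifP => // _.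
by rewrite !path_invE opprB addrC subrK.
Qed.
End path_operations.

Section fundamental_group.
Variables (R : realType) (T : topologicalType) (x : T).
Local Notation loop := {path unit_itv R from x to x in T}.

Definition pi1 : Type := {eq_quot (@homotopic_equiv R T x x)}.

HB.instance Definition _ := Choice.on pi1.
HB.instance Definition _ := EqQuotient.on pi1.

Lemma pi1_eqP (f g : loop) : \pi_pi1 f = \pi_pi1 g <-> homotopic f g.
Proof.
split=> [e|h]; first by apply/asboolP; have /eqmodP := e.
by apply/eqmodP; exact/asboolP.
Qed.

Definition pi1_one : pi1 := \pi_pi1 (cst x).

Definition pi1_mul (a b : pi1) : pi1 := \pi_pi1 (path_concat (repr a) (repr b)).

Definition pi1_inv (a : pi1) : pi1 := \pi_pi1 (path_inv (repr a)).

Lemma repr_pi1 (f : loop) : homotopic (repr (\pi_pi1 f)) f.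
Proof. by apply/pi1_eqP; rewrite reprK. Qed.

Lemma pi1_mulE (f g : loop) :
  pi1_mul (\pi_pi1 f) (\pi_pi1 g) = \pi_pi1 (path_concat f g).
Proof. by apply/pi1_eqP/homotopic_concat; exact: repr_pi1. Qed.

Lemma pi1_invE (f : loop) : pi1_inv (\pi_pi1 f) = \pi_pi1 (path_inv f).
Proof. by apply/pi1_eqP/homotopic_inv/repr_pi1. Qed.

Lemma pi1_mulA : associative pi1_mul.
Proof.
move=> a b c; elim/quotW: a => f; elim/quotW: b => g; elim/quotW: c => h.
rewrite (pi1_mulE g h) (pi1_mulE f g) (pi1_mulE f) (pi1_mulE _ h).
apply/pi1_eqP; exact: concatA.
Qed.

Lemma pi1_mul1g : left_id pi1_one pi1_mul.
Proof. by move=> a; elim/quotW: a => f; rewrite pi1_mulE; apply/pi1_eqP; exact: concat1p. Qed.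

Lemma pi1_mulg1 : right_id pi1_one pi1_mul.
Proof. by move=> a; elim/quotW: a => f; rewrite pi1_mulE; apply/pi1_eqP; exact: concatp1. Qed.

Lemma pi1_mulVg : left_inverse pi1_one pi1_inv pi1_mul.
Proof.
by move=> a; elim/quotW: a => f; rewrite pi1_invE pi1_mulE; apply/pi1_eqP; exact: concatVp.
Qed.

Lemma pi1_mulgV : right_inverse pi1_one pi1_inv pi1_mul.
Proof.
by move=> a; elim/quotW: a => f; rewrite pi1_invE pi1_mulE; apply/pi1_eqP; exact: concatpV.
Qed.

HB.instance Definition _ := isGroup.Build pi1
  pi1_mulA pi1_mul1g pi1_mulg1 pi1_mulVg pi1_mulgV.
End fundamental_group.

(* A chain x = x_0, x_1, ..., x_n = y is encoded by the sequence of x_1, ...,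
   x_n. *)
Section eps_chains.
Context {R : realType} {X : metricType R}.
Implicit Types (eps : R) (x y z : X) (s t : seq X).

Definition is_eps_chain eps x y s :=
  path (fun a b => mdist a b < eps) x s && (last x s == y).

Definition eps_chain eps x y := {s : seq X | is_eps_chain eps x y s}.

Definition EpsChain eps x y s (sP : is_eps_chain eps x y s) : eps_chain eps x y :=
  exist _ s sP.

Definition adds_point s t : Prop :=
  exists s1 z s2, s = s1 ++ s2 /\ t = s1 ++ z :: s2.

Definition basic_move eps x y (c d : eps_chain eps x y) : Prop :=
  adds_point (val c) (val d) \/ adds_point (val d) (val c).

Definition eps_homotopic eps x y : eps_chain eps x y -> eps_chain eps x y -> Prop :=
  clos_refl_trans _ (@basic_move eps x y).

Lemma eps_homotopic_refl eps x y (c : eps_chain eps x y) : eps_homotopic c c.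
Proof. exact: rt_refl. Qed.

Lemma eps_homotopic_trans eps x y (c d e : eps_chain eps x y) :
  eps_homotopic c d -> eps_homotopic d e -> eps_homotopic c e.
Proof. exact: rt_trans. Qed.

Lemma eps_homotopic_sym eps x y (c d : eps_chain eps x y) :
  eps_homotopic c d -> eps_homotopic d c.
Proof.
elim=> [{}c {}d [m|m]|{}c|{}c {}d e _ cd _ de].
- by apply: rt_step; right.
- by apply: rt_step; left.
- exact: rt_refl.
- exact: rt_trans de cd.
Qed.

Let eps_homotopicb eps x y (c d : eps_chain eps x y) := `[< eps_homotopic c d >].

Let eps_homotopicb_refl eps x y : reflexive (@eps_homotopicb eps x y).
Proof. by move=> c; apply/asboolP; exact: eps_homotopic_refl. Qed.

Let eps_homotopicb_sym eps x y : symmetric (@eps_homotopicb eps x y).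
Proof. by move=> c d; apply/asboolP/asboolP; exact: eps_homotopic_sym. Qed.

Let eps_homotopicb_trans eps x y : transitive (@eps_homotopicb eps x y).
Proof.
move=> d c e /asboolP cd /asboolP de; apply/asboolP.
exact: eps_homotopic_trans cd de.
Qed.

Definition eps_homotopic_equiv eps x y :=
  EquivRel (@eps_homotopicb eps x y) (@eps_homotopicb_refl eps x y)
    (@eps_homotopicb_sym eps x y) (@eps_homotopicb_trans eps x y).

(* The relation of [eps]-homotopy on the underlying sequences. *)
Definition ehom eps x y s t : Prop :=
  exists c d : eps_chain eps x y, [/\ val c = s, val d = t & eps_homotopic c d].

Lemma is_eps_chain_cat eps x y s t :
  is_eps_chain eps x y (s ++ t) =
  is_eps_chain eps x (last x s) s && is_eps_chain eps (last x s) y t.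
Proof. by rewrite /is_eps_chain cat_path last_cat eqxx andbT andbA. Qed.

Lemma is_eps_chain_cons eps x y a s :
  is_eps_chain eps x y (a :: s) = (mdist x a < eps) && is_eps_chain eps a y s.
Proof. by rewrite /is_eps_chain /= andbA. Qed.

Lemma is_eps_chain_last eps x y s : is_eps_chain eps x y s -> last x s = y.
Proof. by case/andP => _ /eqP. Qed.

Lemma ehom_valid eps x y s t : ehom eps x y s t ->
  is_eps_chain eps x y s /\ is_eps_chain eps x y t.
Proof. by case=> c [d [<- <- _]]; split; exact: valP. Qed.

Lemma ehom_refl eps x y s : is_eps_chain eps x y s -> ehom eps x y s s.
Proof. by move=> sP; exists (EpsChain sP), (EpsChain sP); split=> //; exact: eps_homotopic_refl. Qed.

Lemma ehom_sym eps x y s t : ehom eps x y s t -> ehom eps x y t s.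
Proof. by case=> c [d [? ? /eps_homotopic_sym cd]]; exists d, c. Qed.

Lemma ehom_trans eps x y s t u :
  ehom eps x y s t -> ehom eps x y t u -> ehom eps x y s u.
Proof.
move=> [c [d [cs dt cd]]] [d' [e [d't eu de]]]; exists c, e; split=> //.
by apply: eps_homotopic_trans cd _; rewrite (_ : d = d') //; apply: val_inj; rewrite dt.
Qed.

Lemma ehom_val eps x y (c d : eps_chain eps x y) :
  ehom eps x y (val c) (val d) <-> eps_homotopic c d.
Proof.
split=> [[c' [d' [/val_inj -> /val_inj -> //]]]|cd].
by exists c, d.
Qed.

Lemma ehom_add eps x y s1 z s2 :
  is_eps_chain eps x y (s1 ++ s2) -> is_eps_chain eps x y (s1 ++ z :: s2) ->
  ehom eps x y (s1 ++ s2) (s1 ++ z :: s2).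
Proof.
move=> c d; exists (EpsChain c), (EpsChain d); split=> //.
by apply: rt_step; left; exists s1, z, s2.
Qed.

Lemma ehom_cat eps x y z s s' t t' : ehom eps x y s s' -> ehom eps y z t t' ->
  ehom eps x z (s ++ t) (s' ++ t').
Proof.
move=> ss' tt'; apply: (@ehom_trans _ _ _ _ (s' ++ t)).
  have [tP _] := ehom_valid tt'; case: ss' => c [d [<- <-]] {s s' tt'}.
  have catP (e : eps_chain eps x y) : is_eps_chain eps x z (val e ++ t).
    rewrite is_eps_chain_cat; have := valP e => eP.
    by rewrite (is_eps_chain_last eP) tP eP.
  elim=> [{}c {}d m|{}c|{}c {}d e _ cd _ de].
  - exists (EpsChain (catP c)), (EpsChain (catP d)); split=> //.
    apply: rt_step; case: m => -[s1 [a [s2 [sE tE]]]]; [left|right];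
      by exists s1, a, (s2 ++ t); rewrite /= sE tE -!catA.
  - by apply: ehom_refl.
  - exact: ehom_trans cd de.
have [_ sP] := ehom_valid ss'; case: tt' => c [d [<- <-]] {t t' ss'}.
have catP (e : eps_chain eps y z) : is_eps_chain eps x z (s' ++ val e).
  by rewrite is_eps_chain_cat (is_eps_chain_last sP) sP; exact: valP.
elim=> [{}c {}d m|{}c|{}c {}d e _ cd _ de].
- exists (EpsChain (catP c)), (EpsChain (catP d)); split=> //.
  apply: rt_step; case: m => -[s1 [a [s2 [sE tE]]]]; [left|right];
    by exists (s' ++ s1), a, s2; rewrite /= sE tE -!catA.
- by apply: ehom_refl.
- exact: ehom_trans cd de.
Qed.

Lemma ehom_cons eps x y a s t : mdist x a < eps -> ehom eps a y s t ->
  ehom eps x y (a :: s) (a :: t).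
Proof.
move=> xa st; apply: (@ehom_cat _ _ a _ [:: a] [:: a]) => //.
by apply: ehom_refl; rewrite is_eps_chain_cons xa /is_eps_chain /= eqxx.
Qed.

Lemma ehom_widen eps eps' x y s t : eps <= eps' ->
  ehom eps x y s t -> ehom eps' x y s t.
Proof.
move=> ee' [c [d [<- <-]]] {s t}.
have W (e : eps_chain eps x y) : is_eps_chain eps' x y (val e).
  have /andP[p l] := valP e; apply/andP; split=> //.
  by apply: sub_path p => a b ab; exact: lt_le_trans ab ee'.
elim=> [{}c {}d m|{}c|{}c {}d e _ cd _ de].
- by exists (EpsChain (W c)), (EpsChain (W d)); split=> //; apply: rt_step.
- by apply: ehom_refl.
- exact: ehom_trans cd de.
Qed.

Definition rev_chain x s := rev (belast x s).

Lemma rev_chainE x s : last x s :: rev_chain x s = rev (x :: s).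
Proof. by rewrite /rev_chain -rev_rcons -lastI. Qed.

Lemma rev_chainK x s : rev_chain (last x s) (rev_chain x s) = s.
Proof.
have := rev_chainE (last x s) (rev_chain x s).
by rewrite (rev_chainE x s) revK => -[].
Qed.

Lemma is_eps_chain_rev eps x y s :
  is_eps_chain eps x y s -> is_eps_chain eps y x (rev_chain x s).
Proof.
case/andP => p /eqP <-; apply/andP; split.
  by rewrite /rev_chain rev_path; apply: sub_path p => a b; rewrite metric_sym.
case: s p => [|a s] _ //=.
by rewrite /rev_chain /= rev_cons last_rcons.
Qed.

Lemma ehom_catV eps x y s : 0 < eps -> is_eps_chain eps x y s ->
  ehom eps x x (s ++ rev_chain x s) [::].
Proof.
move=> e0; elim: s x => [|a s ih] x.
  by move=> _; apply: ehom_refl; rewrite /is_eps_chain /= eqxx.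
rewrite is_eps_chain_cons => /andP[xa sP].
have ax : mdist a x < eps by rewrite metric_sym.
have nilP : is_eps_chain eps x x [::] by rewrite /is_eps_chain /= eqxx.
have xP : is_eps_chain eps x x [:: x] by rewrite is_eps_chain_cons mdistxx e0.
have axP : is_eps_chain eps x x [:: a; x].
  by rewrite is_eps_chain_cons xa is_eps_chain_cons ax.
rewrite /rev_chain /= rev_cons -cats1 -cat_cons catA.
apply: (@ehom_trans _ _ _ _ ([:: a] ++ [:: x])).
  apply: (@ehom_cat _ _ a); first exact/(ehom_cons xa)/ih.
  by apply: ehom_refl; rewrite is_eps_chain_cons ax.
apply: (@ehom_trans _ _ _ _ [:: x]).
  exact/ehom_sym/(@ehom_add _ _ _ [::] a [:: x]).
exact/ehom_sym/(@ehom_add _ _ _ [::] x [::]).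
Qed.

Lemma ehom_catVr eps x y s : 0 < eps -> is_eps_chain eps x y s ->
  ehom eps y y (rev_chain x s ++ s) [::].
Proof.
move=> e0 sP; have := ehom_catV e0 (is_eps_chain_rev sP).
by have := rev_chainK x s; rewrite (is_eps_chain_last sP) => ->.
Qed.

End eps_chains.

Section pi_eps.
Context {R : realType} {X : metricType R}.
Variables (eps : R) (x : X).
Local Notation chain := (eps_chain eps x x).

Definition pi_eps : Type := {eq_quot (@eps_homotopic_equiv R X eps x x)}.

HB.instance Definition _ := Choice.on pi_eps.
HB.instance Definition _ := EqQuotient.on pi_eps.

Lemma pi_eps_eqP (c d : chain) :
  \pi_pi_eps c = \pi_pi_eps d <-> eps_homotopic c d.
Proof.
split=> [e|h]; first by apply/asboolP; have /eqmodP := e.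
by apply/eqmodP; exact/asboolP.
Qed.

Lemma nil_chain_subproof : is_eps_chain eps x x [::].
Proof. by rewrite /is_eps_chain /= eqxx. Qed.

Definition nil_chain : chain := EpsChain nil_chain_subproof.

Lemma cat_chain_subproof (c d : chain) : is_eps_chain eps x x (val c ++ val d).
Proof.
by rewrite is_eps_chain_cat (is_eps_chain_last (valP c)) (valP c) (valP d).
Qed.

Definition cat_chain (c d : chain) : chain := EpsChain (cat_chain_subproof c d).

Definition inv_chain (c : chain) : chain :=
  EpsChain (is_eps_chain_rev (valP c)).

Definition pi_eps_one : pi_eps := \pi_pi_eps nil_chain.

Definition pi_eps_mul (a b : pi_eps) : pi_eps :=
  \pi_pi_eps (cat_chain (repr a) (repr b)).

Definition pi_eps_inv (a : pi_eps) : pi_eps := \pi_pi_eps (inv_chain (repr a)).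

Lemma repr_pi_eps (c : chain) : eps_homotopic (repr (\pi_pi_eps c)) c.
Proof. by apply/pi_eps_eqP; rewrite reprK. Qed.

Lemma pi_eps_mulE (c d : chain) :
  pi_eps_mul (\pi_pi_eps c) (\pi_pi_eps d) = \pi_pi_eps (cat_chain c d).
Proof.
apply/pi_eps_eqP/ehom_val/(@ehom_cat _ _ _ _ x); apply/ehom_val; exact: repr_pi_eps.
Qed.

Lemma pi_eps_mulA : associative pi_eps_mul.
Proof.
move=> a b c; elim/quotW: a => f; elim/quotW: b => g; elim/quotW: c => h.
rewrite (pi_eps_mulE g h) (pi_eps_mulE f g) (pi_eps_mulE f) (pi_eps_mulE _ h).
by congr (\pi_pi_eps _); apply: val_inj; rewrite /= catA.
Qed.

Lemma pi_eps_mul1g : left_id pi_eps_one pi_eps_mul.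
Proof.
move=> a; elim/quotW: a => f; rewrite (pi_eps_mulE nil_chain).
by congr (\pi_pi_eps _); apply: val_inj.
Qed.

Lemma pi_eps_mulg1 : right_id pi_eps_one pi_eps_mul.
Proof.
move=> a; elim/quotW: a => f; rewrite (pi_eps_mulE _ nil_chain).
by congr (\pi_pi_eps _); apply: val_inj; rewrite /= cats0.
Qed.

Lemma chain_nonpos (c : chain) : eps <= 0 -> c = nil_chain.
Proof.
move=> e0; apply: val_inj; case: c => -[//|a s] /=.
by rewrite is_eps_chain_cons ltNge (le_trans e0) ?mdist_ge0.
Qed.

Lemma pi_eps_mulVg : left_inverse pi_eps_one pi_eps_inv pi_eps_mul.
Proof.
move=> a; rewrite -[X in pi_eps_mul _ X]reprK pi_eps_mulE; apply/pi_eps_eqP.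
have [e0|e0] := ltrP 0 eps; last first.
  by rewrite [cat_chain _ _]chain_nonpos //; exact: eps_homotopic_refl.
exact/ehom_val/(ehom_catVr e0)/valP.
Qed.

Lemma pi_eps_mulgV : right_inverse pi_eps_one pi_eps_inv pi_eps_mul.
Proof.
move=> a; rewrite -[X in pi_eps_mul X]reprK pi_eps_mulE; apply/pi_eps_eqP.
have [e0|e0] := ltrP 0 eps; last first.
  by rewrite [cat_chain _ _]chain_nonpos //; exact: eps_homotopic_refl.
exact/ehom_val/(ehom_catV e0)/valP.
Qed.

HB.instance Definition _ := isGroup.Build pi_eps
  pi_eps_mulA pi_eps_mul1g pi_eps_mulg1 pi_eps_mulVg pi_eps_mulgV.
End pi_eps.

Section partitions.
Context {R : realType}.
Implicit Types (a b d t : R) (s w : seq R).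

Lemma lt_path_le_last a s : path <%O a s -> {in a :: s, forall t, t <= last a s}.
Proof.
elim: s a => [|b s ih] a /=; first by move=> _ t; rewrite inE => /eqP ->.
move=> /andP[ab bs] t; rewrite inE => /predU1P[->|]; last exact: ih.
by apply: le_trans (ltW ab) _; apply: ih => //; rewrite mem_head.
Qed.

Lemma lt_path_ge a s : path <%O a s -> {in a :: s, forall t, a <= t}.
Proof.
move=> p t; rewrite inE => /predU1P[->//|ts].
by have /allP/(_ _ ts)/ltW := order_path_min lt_trans p.
Qed.

Lemma lt_path_itv a s : path <%O a s -> {in a :: s, forall t, t \in `[a, last a s]}.
Proof. by move=> p t ts; rewrite in_itv /= (lt_path_ge p) // lt_path_le_last. Qed.

Definition fine_step d t t' := (t < t') && (t' - t < d).

Lemma fine_path_lt d a s : path (fine_step d) a s -> path <%O a s.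
Proof. by apply: sub_path => t t' /andP[]. Qed.

Lemma fine_path d a b : 0 < d -> a <= b ->
  exists2 s, path (fine_step d) a s & last a s = b.
Proof.
move=> d0 ab.
have [n nP] : exists n : nat, b - a < n%:R * (d / 2).
  have d2 : 0 < d / 2 by rewrite divr_gt0.
  exists (Num.truncn ((b - a) / (d / 2))).+1.
  by rewrite -ltr_pdivrMr //; exact: truncnS_gt.
elim: n a ab nP => [a ab|n ih a ab]; first by rewrite mul0r; lra.
rewrite -natr1 mulrDl mul1r => nP.
have [e|ne] := eqVneq a b; first by exists [::].
have ltab : a < b by rewrite lt_neqAle ne.
have [abd|abd] := ltrP (b - a) d.
  by exists [:: b] => //=; rewrite /fine_step ltab abd.
have [||s sP sl] := ih (a + d / 2); [lra|lra|].
by exists (a + d / 2 :: s) => //=; rewrite sP andbT /fine_step; lra.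
Qed.

Lemma fine_refine d a s : 0 < d -> path <%O a s ->
  exists w, [/\ path (fine_step d) a w, last a w = last a s & {subset s <= w}].
Proof.
move=> d0; elim: s a => [|b s ih] a /=; first by exists [::].
move=> /andP[ab /ih[w [wP wl sw]]].
have [v vP vl] := fine_path d0 (ltW ab).
exists (v ++ w); split; [by rewrite cat_path vl vP|by rewrite last_cat vl|].
move=> t; rewrite inE mem_cat => /predU1P[->|/sw ->]; last by rewrite orbT.
have : last a v \in a :: v by rewrite mem_last.
by rewrite vl inE (gt_eqF ab) /= => ->.
Qed.

Lemma common_refine a s s' : path <%O a s -> path <%O a s' ->
  last a s = last a s' ->
  exists w, [/\ path <%O a w, last a w = last a s, {subset s <= w} & {subset s' <= w}].
Proof.
move=> sP s'P e; pose w := sort <=%O (undup (s ++ s')).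
have memw t : (t \in w) = (t \in s) || (t \in s').
  by rewrite mem_sort mem_undup mem_cat.
have wP : path <%O a w.
  rewrite (path_sortedE lt_trans); apply/andP; split.
    apply/allP => t; rewrite memw => /orP[] ts.
      by have /allP := order_path_min lt_trans sP; exact.
    by have /allP := order_path_min lt_trans s'P; exact.
  by rewrite lt_sorted_uniq_le sort_uniq undup_uniq /= sort_le_sorted.
exists w; split=> //; last 2 first.
- by move=> t ts; rewrite memw ts.
- by move=> t ts; rewrite memw ts orbT.
apply/eqP; rewrite eq_le; apply/andP; split.
  have : last a w \in a :: w by rewrite mem_last.
  rewrite inE memw => /predU1P[->|/orP[ts|ts]].
  - by apply: (lt_path_le_last sP); rewrite mem_head.
  - by apply: (lt_path_le_last sP); rewrite inE ts orbT.
  - by rewrite e; apply: (lt_path_le_last s'P); rewrite inE ts orbT.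
apply: (lt_path_le_last wP).
have : last a s \in a :: s by rewrite mem_last.
by rewrite !inE memw => /predU1P[->|->]; rewrite ?eqxx ?orbT.
Qed.
End partitions.

Section strong_chains.
Context {R : realType} {X : metricType R}.
Implicit Types (eps : R) (x y : X) (c : R -> X) (s w : seq R).
Local Notation I := (unit_itv R).

Definition strong_step eps c (t t' : R) : bool :=
  `[< c @` `[t, t'] `<=` ball (c t) eps `&` ball (c t') eps >].

Definition strong_chain eps c s : Prop :=
  itv_partition 0 1 s /\ path (strong_step eps c) 0 s.

Lemma strong_stepP eps c t t' : reflect
  (forall u, t <= u <= t' -> mdist (c u) (c t) < eps /\ mdist (c u) (c t') < eps)
  (strong_step eps c t t').
Proof.
apply: (iffP (asboolP _)) => [h u utt'|h _ [u utt' <-]].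
  have [] := h (c u); first by exists u => //=; rewrite in_itv.
  by rewrite !ballEmdist /= ![mdist _ (c u)]metric_sym.
have [|h1 h2] := h u; first by move: utt'; rewrite /= in_itv.
by rewrite !ballEmdist /= ![mdist _ (c u)]metric_sym.
Qed.

Lemma strong_path_chain eps c a s :
  path <%O a s -> path (strong_step eps c) a s ->
  is_eps_chain eps (c a) (c (last a s)) (map c s).
Proof.
elim: s a => [|b s ih] a /=; first by rewrite /is_eps_chain /= eqxx.
move=> /andP[ab bs] /andP[/strong_stepP sab sbs].
rewrite is_eps_chain_cons ih // andbT.
by have [|_] := sab a; rewrite ?lexx ?(ltW ab).
Qed.

Lemma strong_chain_is_eps_chain eps x y (f : {path I from x to y in X}) s :
  strong_chain eps f s -> is_eps_chain eps x y (map f s).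
Proof.
move=> [[sP /eqP sl] ss]; have := strong_path_chain sP ss.
by rewrite sl path0 path1.
Qed.

Lemma ehom_refine1 eps c t w a :
  path (fun u v => mdist (c u) (c v) < eps) a (rcons w t) ->
  {in w, forall u, mdist (c u) (c t) < eps} -> mdist (c a) (c t) < eps ->
  ehom eps (c a) (c t) [:: c t] (map c w ++ [:: c t]).
Proof.
elim: w a => [|u w ih] a /=.
  by move=> _ _ at'; apply: ehom_refl; rewrite is_eps_chain_cons at' /is_eps_chain /= eqxx.
move=> /andP[au uw] wt at'.
have ut : mdist (c u) (c t) < eps by apply: wt; rewrite mem_head.
have ttP : is_eps_chain eps (c t) (c t) [::] by rewrite /is_eps_chain /= eqxx.
apply: (@ehom_trans _ _ _ _ _ _ [:: c u; c t]).
  by apply: (@ehom_add _ _ _ _ _ [::] (c u) [:: c t]); rewrite /= !is_eps_chain_cons ?au ?ut ?at' ttP.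
apply: ehom_cons => //; apply: ih => // v vw; apply: wt.
by rewrite inE vw orbT.
Qed.

Lemma ehom_refine eps c s w a :
  path <%O a s -> path (strong_step eps c) a s ->
  path <%O a w -> path (fun u v => mdist (c u) (c v) < eps) a w ->
  last a w = last a s -> {subset s <= w} ->
  ehom eps (c a) (c (last a s)) (map c s) (map c w).
Proof.
elim: s a w => [|t s ih] a w.
  move=> _ _; case: w => [|b w] /=.
    by move=> *; apply: ehom_refl; rewrite /is_eps_chain /= eqxx.
  move=> /andP[ab bw] _ e _; have := lt_path_le_last bw.
  by rewrite e => /(_ b); rewrite mem_head leNgt ab => /(_ isT).
move=> /= /andP[at' ts] /andP[/strong_stepP sat sts] wP wc wl sw.
have tw : t \in w by apply: sw; rewrite mem_head.
case/splitPr: tw wP wc wl sw => w1 w2.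
rewrite -cat_rcons !cat_path last_cat !last_rcons => /andP[w1P w2P] /andP[w1c w2c] wl sw.
rewrite map_cat map_rcons -cats1 -[c t :: map c s]/([:: c t] ++ map c s).
have w1lt u : u \in w1 -> a < u < t.
  move=> uw; have := order_path_min lt_trans w1P.
  rewrite all_rcons => /andP[_ /allP/(_ _ uw)] -> /=.
  move: w1P; rewrite -cats1 cat_path /= andbT => /andP[w1P lt1].
  apply: le_lt_trans lt1; apply: (lt_path_le_last w1P).
  by rewrite inE uw orbT.
apply: (@ehom_cat _ _ _ _ (c t)).
  apply: ehom_refine1 => //.
    by move=> u /w1lt /andP[au ut]; have [|_] := sat u; rewrite ?(ltW au) ?(ltW ut).
  by have [|_] := sat a; rewrite ?lexx ?(ltW at').
apply: ih => // u us; have := sw u; rewrite inE us orbT => /(_ isT).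
have tu : t < u by have /allP/(_ _ us) := order_path_min lt_trans ts.
rewrite mem_cat mem_rcons inE (gt_eqF tu) /= => /orP[/w1lt|//].
by rewrite [u < t]ltNge (ltW tu) andbF.
Qed.

Lemma fine_path_close eps d c s :
  (forall t t', t \in `[0, 1] -> t' \in `[0, 1] -> `|t - t'| < d ->
    mdist (c t) (c t') < eps) ->
  path (fine_step d) 0 s -> last 0 s = 1 ->
  path (fun u v => mdist (c u) (c v) < eps) 0 s.
Proof.
move=> uc sP sl; have slt := fine_path_lt sP.
apply: (sub_in_path (P := [in `[0, 1]]) _ _ sP) => [t t' t01 t'01|].
  move=> /andP[tt' t'td]; apply: uc => //.
  by rewrite distrC ger0_norm // subr_ge0 ltW.
by apply/allP => t /(lt_path_itv slt); rewrite sl.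
Qed.

Lemma fine_path_strong eps d c s :
  (forall t t', t \in `[0, 1] -> t' \in `[0, 1] -> `|t - t'| < d ->
    mdist (c t) (c t') < eps) ->
  path (fine_step d) 0 s -> last 0 s = 1 -> strong_chain eps c s.
Proof.
move=> uc sP sl; have slt := fine_path_lt sP; split; first by split=> //; apply/eqP.
apply: (sub_in_path (P := [in `[0, 1]]) _ _ sP) => [t t' t01 t'01|].
  move=> /andP[tt' t'td]; apply/strong_stepP => u /andP[tu ut'].
  have u01 : u \in `[0, 1].
    by move: t01 t'01; rewrite !in_itv /= => /andP[? ?] /andP[? ?]; lra.
  by split; apply: uc => //; [rewrite ger0_norm|rewrite distrC ger0_norm]; lra.
by apply/allP => t /(lt_path_itv slt); rewrite sl.
Qed.

Lemma path_unif_continuous eps x y (f : {path I from x to y in X}) : 0 < eps ->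
  exists2 d, 0 < d & forall t t' : R, t \in `[0, 1] -> t' \in `[0, 1] ->
    `|t - t'| < d -> mdist (f t) (f t') < eps.
Proof.
move=> e0.
have [d d0 dP] := compact_unif_continuous (@segment_compact R 0 1)
  (@path_clamp_continuous _ _ _ _ f) e0.
exists d => // t t' t01 t'01 tt'.
by have := dP t t' t01 tt'; rewrite !clampE // ballEmdist.
Qed.

Lemma strong_chain_ex eps x y (f : {path I from x to y in X}) : 0 < eps ->
  exists s, strong_chain eps f s.
Proof.
move=> e0; have [d d0 dP] := path_unif_continuous f e0.
have [s sP sl] := fine_path d0 (@ler01 R).
by exists s; exact: fine_path_strong dP sP sl.
Qed.

Lemma strong_chain_ehom eps x y (f : {path I from x to y in X}) s s' :
  0 < eps -> strong_chain eps f s -> strong_chain eps f s' ->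
  ehom eps x y (map f s) (map f s').
Proof.
move=> e0 [[sP /eqP sl] ss] [[s'P /eqP s'l] ss'].
have [d d0 dP] := path_unif_continuous f e0.
have [|u [uP ul su s'u]] := common_refine sP s'P; first by rewrite sl.
have [w [wP wl uw]] := fine_refine d0 uP.
have wl1 : last 0 w = 1 by rewrite wl ul.
have wc := fine_path_close dP wP wl1; have wlt := fine_path_lt wP.
apply: (@ehom_trans _ _ _ _ _ _ (map f w)).
  have := @ehom_refine eps f s w 0 sP ss wlt wc; rewrite sl path0 path1; apply=> //.
  by move=> t /su/uw.
apply: ehom_sym.
have := @ehom_refine eps f s' w 0 s'P ss' wlt wc; rewrite s'l path0 path1; apply=> //.
by move=> t /s'u/uw.
Qed.

Lemma ehom_ladder eps (p q : R -> X) d a w y :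
  (forall t t', t \in a :: w -> t' \in a :: w -> `|t - t'| < d ->
    [/\ mdist (p t) (p t') < eps, mdist (p t) (q t') < eps &
        mdist (q t) (q t') < eps]) -> 0 < d ->
  path (fine_step d) a w -> p (last a w) = y -> q (last a w) = y ->
  ehom eps (q a) y (p a :: map p w) (map q w).
Proof.
move=> uc d0; elim: w a uc => [|b w ih] a uc /=.
  move=> _ pa qa; have yP : is_eps_chain eps y y [::] by rewrite /is_eps_chain /= eqxx.
  rewrite pa qa; apply/ehom_sym/(@ehom_add _ _ _ _ _ [::] y [::]) => //=.
  rewrite is_eps_chain_cons yP andbT -{1}pa -qa.
  by have [|||] := uc a a; rewrite ?mem_head ?subrr ?normr0.
move=> /andP[/andP[ab bad] bw] pl ql.
have {}ih : ehom eps (q b) y (p b :: map p w) (map q w).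
  by apply: ih => // t t' tw t'w; apply: uc; rewrite inE ?tw ?t'w orbT.
have [] := ehom_valid ih; rewrite is_eps_chain_cons => /andP[qbpb pP] qP.
have nab : `|a - b| < d by rewrite distrC ger0_norm // subr_ge0 ltW.
have ain : a \in [:: a, b & w] by rewrite mem_head.
have bin : b \in [:: a, b & w] by rewrite !inE eqxx orbT.
have [pab paqb qab] := uc a b ain bin nab.
have [|_ paqa _] := uc a a ain ain; first by rewrite subrr normr0.
have qapa : mdist (q a) (p a) < eps by rewrite metric_sym.
apply: (@ehom_trans _ _ _ _ _ _ [:: p a, q b, p b & map p w]).
  apply: (@ehom_add _ _ _ _ _ [:: p a] (q b)); rewrite /= !is_eps_chain_cons qapa.
    by rewrite pab.
  by rewrite paqb qbpb.
apply: (@ehom_trans _ _ _ _ _ _ [:: q b, p b & map p w]).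
  apply/ehom_sym/(@ehom_add _ _ _ _ _ [::] (p a)); rewrite /= !is_eps_chain_cons.
    by rewrite qab qbpb.
  by rewrite qapa paqb qbpb.
exact: ehom_cons.
Qed.

Lemma homotopic_ehom eps x y (f g : {path I from x to y in X}) s s' :
  0 < eps -> homotopic f g -> strong_chain eps f s -> strong_chain eps g s' ->
  ehom eps x y (map f s) (map g s').
Proof.
move=> e0 /homotopicP[H [cH H0 H1 Hs]] fs gs.
pose square := [set` `[0 : R, 1]] `*` [set` `[0 : R, 1]].
have cK : compact square by apply: compact_setX; exact: segment_compact.
have [d d0 dP] := compact_unif_continuous cK cH e0.
have uc (t t' u u' : R) : t \in `[0, 1] -> u \in `[0, 1] ->
    `|t - t'| < d -> `|u - u'| < d -> mdist (H (t, u)) (H (t', u')) < eps.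
  by move=> t01 u01 tt' uu'; have := dP (t, u) (t', u'); rewrite ballEmdist; apply.
have dd : `|0 : R| < d by rewrite normr0.
have i0 : (0 : R) \in `[0, 1] by rewrite in_itv /= lexx ler01.
have i1 : (1 : R) \in `[0, 1] by rewrite in_itv /= lexx ler01.
have [w wP wl] := fine_path d0 (@ler01 R); have wlt := fine_path_lt wP.
have w01 t : t \in 0 :: w -> t \in `[0, 1] by move/(lt_path_itv wlt); rewrite wl.
have fw : strong_chain eps f w.
  apply: fine_path_strong wP wl => t t' t01 t'01 tt'.
  by rewrite -!H0 //; apply: uc; rewrite ?subrr.
have gw : strong_chain eps g w.
  apply: fine_path_strong wP wl => t t' t01 t'01 tt'.
  by rewrite -!H1 //; apply: uc; rewrite ?subrr.
apply: ehom_trans (strong_chain_ehom e0 fs fw) _.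
apply: ehom_trans (strong_chain_ehom e0 gw gs).
have mapE (h : {path I from x to y in X}) (u : R) :
    (forall t, t \in `[0, 1] -> H (t, u) = h t) ->
    map h w = map (fun t => H (t, u)) w.
  by move=> hH; apply/eq_in_map => t tw; rewrite hH //; apply: w01; rewrite inE tw orbT.
rewrite (mapE _ _ H0) (mapE _ _ H1) => {mapE}.
have step u u' : u \in `[0, 1] -> u' \in `[0, 1] -> `|u - u'| < d ->
    ehom eps x y (map (fun t => H (t, u)) w) (map (fun t => H (t, u')) w).
  move=> u01 u'01 uu'.
  have [Hu0 Hu1] := Hs _ u01; have [Hu'0 Hu'1] := Hs _ u'01.
  have L : ehom eps x y (H (0, u) :: map (fun t => H (t, u)) w)
      (map (fun t => H (t, u')) w).
    have := @ehom_ladder eps (fun t => H (t, u)) (fun t => H (t, u')) d 0 w y.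
    rewrite wl Hu'0; apply=> // t t' /w01 t01 /w01 t'01 tt'.
    by split; apply: uc; rewrite ?subrr.
  have [cP _] := ehom_valid L; apply: ehom_trans L; rewrite Hu0 in cP *.
  move: (cP); rewrite is_eps_chain_cons => /andP[_ cP'].
  exact: (@ehom_add _ _ _ _ _ [::] x _ cP' cP).
have [v vP vl] := fine_path d0 (@ler01 R).
have chain a : path (fine_step d) a v -> {in a :: v, forall t, t \in `[0, 1]} ->
    ehom eps x y (map (fun t => H (t, a)) w) (map (fun t => H (t, last a v)) w).
  elim: v {vP vl} a => [|b v ih] a /=.
    move=> _ a01; have a01' : a \in `[0, 1] by apply: a01; rewrite mem_head.
    by have [] := ehom_valid (step a a a01' a01' _); rewrite ?subrr ?normr0 // => /ehom_refl.
  move=> /andP[/andP[ab bad] bv] v01.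
  have a01 : a \in `[0, 1] by apply: v01; rewrite mem_head.
  have b01 : b \in `[0, 1] by apply: v01; rewrite !inE eqxx orbT.
  apply: (@ehom_trans _ _ _ _ _ _ (map (fun t => H (t, b)) w)).
    by apply: step => //; rewrite distrC ger0_norm // subr_ge0 ltW.
  by apply: ih => // t tv; apply: v01; rewrite inE tv orbT.
have := chain 0 vP; rewrite vl; apply=> t /(lt_path_itv (fine_path_lt vP)).
by rewrite vl.
Qed.
End strong_chains.

Section covering_topology.
Context {R : realType} {X : metricType R}.
Variable x : X.
Implicit Types (eps : R) (f g : {path unit_itv R from x to x in X}).
Local Notation pi1 := (pi1 R x).

(* For [eps > 0] and [a : pi1] this set is a singleton: see [h_epsE]. *)
Definition strong_chain_classes eps (a : pi1) : set (pi_eps eps x) :=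
  [set b | exists f (s : seq R) (c : eps_chain eps x x),
    [/\ \pi_pi1 f = a, strong_chain eps f s, val c = map f s & b = \pi_(pi_eps eps x) c]].

Arguments strong_chain_classes : clear implicits.

Definition h_eps eps (a : pi1) : pi_eps eps x :=
  xget 1%g (strong_chain_classes eps a).

Arguments h_eps : clear implicits.

Lemma h_epsE eps f s (c : eps_chain eps x x) : 0 < eps ->
  strong_chain eps f s -> val c = map f s -> h_eps eps (\pi_pi1 f) = \pi_(pi_eps eps x) c.
Proof.
move=> e0 fs cE; rewrite /h_eps.
have : strong_chain_classes eps (\pi f) (\pi c) by exists f, s, c.
move=> /(xgetI 1%g)[g [t [d [/pi1_eqP gf gt dE ->]]]].
by apply/pi_eps_eqP/ehom_val; rewrite cE dE; exact: homotopic_ehom gf gt fs.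
Qed.

Lemma strong_chain_concat eps f g s t :
  strong_chain eps f s -> strong_chain eps g t ->
  strong_chain eps (path_concat f g)
    (map (fun u => u / 2) s ++ map (fun u => (1 + u) / 2) t).
Proof.
move=> [[sP /eqP sl] ss] [[tP /eqP tl] st].
have lasts : last 0 [seq u / 2 | u <- s] = (1 + 0) / 2.
  by have := last_map (fun u => u / 2) s 0; rewrite mul0r sl addr0.
have pathE (r : rel R) :
    path r 0 ([seq u / 2 | u <- s] ++ [seq (1 + u) / 2 | u <- t]) =
    path [rel u v | r (u / 2) (v / 2)] 0 s &&
    path [rel u v | r ((1 + u) / 2) ((1 + v) / 2)] 0 t.
  have := @path_map _ _ (fun u => u / 2) r 0 s; rewrite mul0r cat_path => ->.
  by rewrite lasts (@path_map _ _ (fun u => (1 + u) / 2)).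
have s01 u : u \in 0 :: s -> u \in `[0, 1] by move/(lt_path_itv sP); rewrite sl.
have t01 u : u \in 0 :: t -> u \in `[0, 1] by move/(lt_path_itv tP); rewrite tl.
have fE u : u <= 2^-1 -> path_concat f g u = f (2 * u).
  by move=> u2; rewrite path_concatE /concat_fun u2.
have gE u : 2^-1 <= u -> path_concat f g u = g (2 * u - 1).
  rewrite le_eqVlt => /predU1P[<-|u2].
    by rewrite fE // mulfV // subrr path1 path0.
  by rewrite path_concatE /concat_fun ifF //; apply/negbTE; rewrite -ltNge.
split; first split.
- by rewrite pathE; apply/andP; split; [apply: sub_path sP|apply: sub_path tP] => u v /= uv; lra.
- by apply/eqP; rewrite last_cat lasts (last_map (fun u => (1 + u) / 2)) tl; lra.
- rewrite pathE; apply/andP; split.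
    apply: (sub_in_path (P := [in `[0, 1]]) _ _ ss); last exact/allP.
    move=> u v /itvP u01 /itvP v01 /strong_stepP h.
  have [u0 u1] : 0 <= u /\ u <= 1 by rewrite !u01.
  have [v0 v1] : 0 <= v /\ v <= 1 by rewrite !v01.
    apply/strong_stepP => r /andP[ur rv].
    have [|h1 h2] := h (2 * r); first by lra.
    by rewrite !fE; try lra; rewrite ![2 * (_ / 2)]mulrC !divfK.
  apply: (sub_in_path (P := [in `[0, 1]]) _ _ st); last exact/allP.
  move=> u v /itvP u01 /itvP v01 /strong_stepP h.
  have [u0 u1] : 0 <= u /\ u <= 1 by rewrite !u01.
  have [v0 v1] : 0 <= v /\ v <= 1 by rewrite !v01.
  apply/strong_stepP => r /andP[ur rv].
  have [|h1 h2] := h (2 * r - 1); first by lra.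
  have E (w : R) : 2 * ((1 + w) / 2) - 1 = w by lra.
  by rewrite !gE; try lra; rewrite !E.
Qed.

Lemma h_epsM eps : 0 < eps -> {morph h_eps eps : a b / (a * b)%g}.
Proof.
move=> e0 a b; elim/quotW: a => f; elim/quotW: b => g.
have [s fs] := strong_chain_ex f e0; have [t gt] := strong_chain_ex g e0.
pose c := EpsChain (strong_chain_is_eps_chain fs).
pose d := EpsChain (strong_chain_is_eps_chain gt).
rewrite [LHS](_ : _ = h_eps eps (\pi_pi1 (path_concat f g))); last first.
  by congr (h_eps eps _); exact: pi1_mulE.
rewrite (@h_epsE _ f s c) // (@h_epsE _ g t d) //.
rewrite [RHS](_ : _ = \pi_(pi_eps eps x) (cat_chain c d)); last exact: pi_eps_mulE.
apply: (h_epsE e0 (strong_chain_concat fs gt)).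
have [[sP /eqP sl] _] := fs; have [[tP /eqP tl] _] := gt.
rewrite /= map_cat -!map_comp; congr (_ ++ _); apply/eq_in_map => u us /=.
  have : u \in `[0, 1] by have := lt_path_itv sP; rewrite sl; apply; rewrite inE us orbT.
  rewrite in_itv /= => /andP[u0 u1]; rewrite path_concatE /concat_fun ifT; last by lra.
  by rewrite mulrC divfK.
have u0 : 0 < u by have /allP/(_ _ us) := order_path_min lt_trans tP.
rewrite path_concatE /concat_fun ifF; last by apply/negbTE; rewrite -ltNge; lra.
by congr (g _); lra.
Qed.

Lemma h_eps1 eps : 0 < eps -> h_eps eps 1%g = 1%g.
Proof.
by move=> e0; apply: (mulgI (h_eps eps 1%g)); rewrite -h_epsM // !mulg1.
Qed.

Lemma h_epsV eps a : 0 < eps -> h_eps eps a^-1%g = (h_eps eps a)^-1%g.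
Proof.
move=> e0; apply: (mulgI (h_eps eps a)).
by rewrite -h_epsM // !mulgV h_eps1.
Qed.

Definition K_eps eps : set pi1 := [set a | h_eps eps a = 1%g].

Definition pi_cl : set pi1 := \bigcap_(eps in [set e : R | 0 < e]) K_eps eps.

Lemma K_eps1 eps : 0 < eps -> K_eps eps 1%g. Proof. exact: h_eps1. Qed.

Lemma K_epsM eps a b : 0 < eps -> K_eps eps a -> K_eps eps b -> K_eps eps (a * b)%g.
Proof. by move=> e0; rewrite /K_eps /= h_epsM // => -> ->; rewrite mulg1. Qed.

Lemma K_epsV eps a : 0 < eps -> K_eps eps a -> K_eps eps a^-1%g.
Proof. by move=> e0; rewrite /K_eps /= h_epsV // => ->; rewrite invg1. Qed.

Lemma K_eps_subset eps eps' : 0 < eps -> eps <= eps' -> K_eps eps `<=` K_eps eps'.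
Proof.
move=> e0 ee' a; elim/quotW: a => f; rewrite /K_eps /=.
have [s fs] := strong_chain_ex f e0.
have fs' : strong_chain eps' f s.
  have [p ss] := fs; split=> //; apply: sub_path ss => t t' /strong_stepP h.
  apply/strong_stepP => u /h[h1 h2].
  by split; [apply: lt_le_trans h1 _|apply: lt_le_trans h2 _].
pose c := EpsChain (strong_chain_is_eps_chain fs).
pose c' := EpsChain (strong_chain_is_eps_chain fs').
rewrite (@h_epsE _ f s c) // (@h_epsE _ f s c') //; last exact: lt_le_trans ee'.
move=> /(pi_eps_eqP c (nil_chain _ _))/ehom_val/(ehom_widen ee') h.
by apply/(pi_eps_eqP c' (nil_chain _ _))/ehom_val.
Qed.

Definition left_coset (a : pi1) (A : set pi1) : set pi1 := [set (a * k)%g | k in A].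

Definition pi1C : Type := pi1.

HB.instance Definition _ := Group.on pi1C.
HB.instance Definition _ := isPointed.Build pi1C (1%g : pi1).

Let coset_idx : set (pi1C * R) := [set i | 0 < i.2].
Let coset (i : pi1C * R) : set pi1C := left_coset i.1 (K_eps i.2).

Lemma coset_cover : \bigcup_(i in coset_idx) coset i = setT.
Proof.
apply/seteqP; split=> // a _; exists (a, 1); first exact: ltr01.
by exists 1%g; [exact: K_eps1|rewrite mulg1].
Qed.

Lemma coset_join (i j : pi1C * R) (a : pi1C) :
  coset_idx i -> coset_idx j -> coset i a -> coset j a ->
  exists k, [/\ coset_idx k, coset k a & coset k `<=` coset i `&` coset j].
Proof.
move: i j => [b e] [b' e']; rewrite /coset_idx /coset /= => e0 e'0.
move=> [k kK kE] [k' k'K k'E].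
have m0 : 0 < Num.min e e' by rewrite lt_min e0.
exists (a, Num.min e e'); split=> //=.
  by exists 1%g; [exact: K_eps1|rewrite mulg1].
move=> _ [l lK <-]; split.
- exists (k * l)%g; last by rewrite mulgA kE.
  by apply: K_epsM => //; apply: K_eps_subset lK => //; rewrite ge_min lexx.
- exists (k' * l)%g; last by rewrite mulgA k'E.
  by apply: K_epsM => //; apply: K_eps_subset lK => //; rewrite ge_min lexx orbT.
Qed.

HB.instance Definition _ := isBaseTopological.Build pi1C coset_cover coset_join.

Lemma pi1C_openP (U : set pi1C) :
  open U <-> forall a, U a -> exists2 eps : R, 0 < eps & left_coset a (K_eps eps) `<=` U.
Proof.
split=> [[D DP <-] a [[b e] Di] /= ab|h].
  have e0 := DP _ Di; exists e => //= _ [k kK <-]; exists (b, e) => //=.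
  case: ab => l lK <-; exists (l * k)%g; last by rewrite mulgA.
  exact: K_epsM.
exists [set i : pi1C * R | 0 < i.2 /\ coset i `<=` U]; first by move=> i [].
apply/seteqP; split=> [a [i [_ iU]] /iU //|a /h[e e0 eU]].
exists (a, e) => //; exists 1%g; [exact: K_eps1|by rewrite mulg1].
Qed.

Let pi_cl_rel (a b : pi1C) : bool := `[< pi_cl (a^-1 * b)%g >].

Let pi_cl_refl : reflexive pi_cl_rel.
Proof. by move=> a; apply/asboolP => e e0; rewrite mulVg; exact: K_eps1. Qed.

Let pi_cl_sym : symmetric pi_cl_rel.
Proof.
by move=> a b; apply/asboolP/asboolP => h e e0;
  have := K_epsV e0 (h e e0); rewrite invgM invgK.
Qed.

Let pi_cl_trans : transitive pi_cl_rel.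
Proof.
move=> b a c /asboolP ab /asboolP bc; apply/asboolP => e e0.
by have := K_epsM e0 (ab e e0) (bc e e0); rewrite -mulgA mulVKg.
Qed.

Definition pi_cl_equiv := EquivRel pi_cl_rel pi_cl_refl pi_cl_sym pi_cl_trans.

Definition pi1C_bar : Type := quotient_topology {eq_quot pi_cl_equiv}.

HB.instance Definition _ := Topological.on pi1C_bar.
End covering_topology.

Definition discrete_space (T : topologicalType) : Prop := forall A : set T, open A.

Section covers.
Implicit Types X Y Z : topologicalType.

Definition homeomorphic_on Y X (f : Y -> X) (V : set Y) (U : set X) : Prop :=
  [/\ set_bij V U f, {within V, continuous f} &
      exists2 g : X -> Y, {in V, cancel f g} & {within U, continuous g}].

Definition evenly_covered Y X (f : Y -> X) (U : set X) : Prop :=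
  exists F : set (set Y),
  [/\ trivIset F id, f @^-1` U = \bigcup_(V in F) V &
      forall V, F V -> open V /\ homeomorphic_on f V U].

Definition is_cover Y X (f : Y -> X) : Prop :=
  [/\ connected [set: Y], continuous f, (forall x, exists y, f y = x) &
      forall x, exists U, [/\ open U, U x & evenly_covered f U]].

Definition is_universal_cover Y X (f : Y -> X) : Prop :=
  is_cover f /\
  forall Z (g : Z -> X), is_cover g ->
    exists h : Y -> Z, is_cover h /\ g \o h = f.

Definition has_universal_cover X : Prop :=
  exists Y (f : Y -> X), is_universal_cover f.

Definition simply_connected (R : realType) Y : Prop :=
  (forall y z : Y, inhabited {path unit_itv R from y to z in Y}) /\
  forall (y : Y) (a : pi1 R y), a = 1%g.

Definition has_simply_connected_cover (R : realType) X : Prop :=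
  exists Y (f : Y -> X), is_cover f /\ simply_connected R Y.
End covers.

Section geodesic.
Context {R : realType}.

Definition curve_length (X : metricType R) (f : R -> X) : \bar R :=
  ereal_sup [set (\sum_(i < size s) mdist (f (nth 0 (0 :: s) i)) (f (nth 0 s i)))%:E
             | s in itv_partition 0 1].

Definition geodesic (X : metricType R) : Prop :=
  forall x y : X, exists f : {path unit_itv R from x to y in X},
    curve_length f = (mdist x y)%:E.
End geodesic.

(* Main.v *)
From HB Require Import structures.
Require Import Defs.
From mathcomp Require Import all_boot all_order all_algebra.
From mathcomp Require Import boolp classical_sets functions reals ereal.
From mathcomp Require Import topology normedtype continuous_path.
From mathcomp Require Import lra.

(** Coverings of a compact geodesic space [X] are studied through chains.  By
    compactness, a covering [g : Z -> X] has a Lebesgue number, hence a radius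
    [d] such that every point [z] has a sheet over the ball of radius [d] about
    [g z].  Moving inside sheets defines a map [T : Z -> X -> Z], called a
    transport, and [transport_of_cover] shows that it satisfies the cocycle
    condition [T (T z y) y' = T z y'] for triples of points at mutual distances
    less than [d]; this is where paths that stay in balls, such as geodesics,
    are used.  The condition says precisely that transport along [d]-chains is
    invariant under basic moves ([foldl_transport_ehom]), and transport along a
    strong chain of a path computes the end of the lift of that path
    ([foldl_transport_path]).  Hence the loops of [K_eps d] lift to loops.

    Conversely, for each [eps > 0] the classes of [eps]-chains that start at [x]
    form a space [chain_space eps x], with a transport of radius [eps] given by
    appending a point to a chain.  It is a connected covering of [X]
    ([chain_space_cover]), and a loop of [X] lifts to a loop of it only if it
    belongs to [K_eps eps] ([foldl_extend_loop]).

    Both topological conditions on the fundamental group say that the groups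
    [K_eps eps] are eventually as small as they can be: [K_eps eps] is included
    in [pi_cl], or trivial, for some [eps > 0] ([discrete_pi1C_barP] and
    [discrete_pi1CP]).

    If [Y] is a universal cover with a transport of radius [d], a loop of
    [K_eps d] lifts to a loop of [Y], which maps to a loop of each
    [chain_space eps x], so that it belongs to [K_eps eps]: thus [K_eps d] is
    included in [pi_cl] ([universal_cover_K_eps]).  Conversely, if [K_eps e] is
    included in [pi_cl] then [chain_space e x] is universal: given a covering
    [Z] and a small radius [d] of transport, every class of [e]-chains contains
    [d]-chains, and sending it to the transport of one of these is well defined
    because [e]-homotopic [d]-chains are [d]-homotopic ([ehom_refine_eps], which
    rests on the inclusion of [K_eps e] in [K_eps d]).

    If [Y] is simply connected with a transport of radius [d], a loop of
    [K_eps d] lifts to a loop of [Y], where it is null-homotopic, so [K_eps d]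
    is trivial.  Conversely, if [K_eps e] is trivial, then every loop of
    [chain_space e x] projects to a null-homotopic loop, and lifting the
    homotopy ([lift_homotopic_cst]) shows that it is itself null-homotopic. *)

Set Implicit Arguments.
Unset Strict Implicit.
Unset Printing Implicit Defensive.

Import Order.TTheory GRing.Theory Num.Theory.
Import numFieldNormedType.Exports.

Local Open Scope classical_set_scope.
Local Open Scope ring_scope.
Local Open Scope quotient_scope.

(** * Connectedness and distances *)

(** The form in which connectedness is used everywhere below: it spares the
    separate verification that a set is open and that it is closed. *)
Lemma connected_locally_constant (D : topologicalType) (P : set D) :
  connected [set: D] -> (forall a, \forall b \near a, P a <-> P b) ->
  forall a b, P a -> P b.
Proof.
move=> Dc Ploc a b Pa.
have oP : open P.
  by rewrite openE => c Pc; apply: filterS (Ploc c) => e [+ _]; apply.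
have oCP : open (~` P).
  by rewrite openE => c Pc; apply: filterS (Ploc c) => e [_ Pe] /Pe.
suff -> : P = setT by [].
apply: Dc; first by exists a.
- by exists P; rewrite ?setTI.
- by exists P; rewrite ?setTI // -openC.
Qed.

Lemma connected_real (R : realType) : connected [set: R].
Proof. exact/connected_intervalP. Qed.

Lemma near_mdist (R : realType) (X : metricType R) (x : X) (e : R) :
  0 < e -> \forall y \near x, mdist x y < e.
Proof.
by move=> e0; have := nbhsx_ballx x _ e0; rewrite ballEmdist.
Qed.

Lemma near_mdist_lt (R : realType) (X : metricType R) (D : topologicalType)
    (u v : D -> X) (e : R) (a : D) :
  {for a, continuous u} -> {for a, continuous v} -> mdist (u a) (v a) < e ->
  \forall b \near a, mdist (u b) (v b) < e.
Proof.
move=> cu cv uv; pose r := (e - mdist (u a) (v a)) / 2.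
have r0 : 0 < r by rewrite divr_gt0 // subr_gt0.
have nu : \forall b \near a, mdist (u a) (u b) < r.
  exact: cu (near_mdist (u a) r0).
have nv : \forall b \near a, mdist (v a) (v b) < r.
  exact: cv (near_mdist (v a) r0).
near=> b.
have : mdist (u a) (u b) < r by near: b.
have : mdist (v a) (v b) < r by near: b.
have := metric_triangle (u b) (u a) (v b).
have := metric_triangle (u a) (v a) (v b).
by rewrite (metric_sym (u b) (u a)) /r; lra.
Unshelve. all: by end_near. Qed.

(** * Transport *)

(** [T z y] is the point over [y] in the sheet of [z], for [y] at distance less
    than [d] from the image of [z].  All the coverings of a compact geodesic
    space are of this form, with one [d] for the whole space, and so are the
    spaces of classes of [eps]-chains; the axioms replace the topology of a
    covering by the combinatorics of chains in the base. *)
Record transport (R : realType) (X : metricType R) (Z : topologicalType)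
    (g : Z -> X) (d : R) (T : Z -> X -> Z) : Prop := Transport {
  transport_gt0 : 0 < d;
  transport_proj : forall z y, mdist (g z) y < d -> g (T z y) = y;
  transport_id : forall z, T z (g z) = z;
  transport_comp : forall z y y', mdist (g z) y < d -> mdist (g z) y' < d ->
    mdist y y' < d -> T (T z y) y' = T z y';
  transport_nbhs : forall z (A : set Z),
    nbhs z A <-> \forall y \near g z, A (T z y) }.

Section transport_theory.
Context {R : realType} {X : metricType R}.
Implicit Types (Z D : topologicalType) (d : R).

Lemma transport_sub Z (g : Z -> X) d d' T :
  0 < d' -> d' <= d -> transport g d T -> transport g d' T.
Proof.
move=> d'0 d'd [_ proj id comp nb]; split=> // [z y zy|z y y' zy zy' yy'].
  by apply: proj; exact: lt_le_trans d'd.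
by apply: comp; exact: lt_le_trans d'd.
Qed.

Lemma transport_identity d : 0 < d -> transport (@id X) d (fun _ y => y).
Proof. by move=> d0; split. Qed.

Section one_transport.
Context {Z : topologicalType} {g : Z -> X} {d : R} {T : Z -> X -> Z}.
Hypothesis tr : transport g d T.

Lemma transport_continuous_proj : continuous g.
Proof.
move=> z A zA; apply/(transport_nbhs tr).
near=> y; rewrite /= (transport_proj tr); first by near: y.
by near: y; apply: near_mdist; exact: transport_gt0 tr.
Unshelve. all: by end_near. Qed.

Lemma near_transport z : \forall z' \near z,
  mdist (g z) (g z') < d /\ T z (g z') = z'.
Proof.
apply/(transport_nbhs tr); near=> y.
have zy : mdist (g z) y < d.
  by near: y; apply: near_mdist; exact: transport_gt0 tr.
by rewrite (transport_proj tr).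
Unshelve. all: by end_near. Qed.

Lemma transportK z y : mdist (g z) y < d -> T (T z y) (g z) = z.
Proof.
move=> zy; rewrite (transport_comp tr) ?(transport_id tr) //.
  by rewrite mdistxx; exact: transport_gt0 tr.
by rewrite metric_sym.
Qed.

Lemma transport_inj z z' y : g z = g z' -> mdist (g z) y < d ->
  T z y = T z' y -> z = z'.
Proof.
by move=> zz' zy e; rewrite -(transportK zy) e zz' transportK // -zz'.
Qed.

(** Near [a], the point [L b] is itself the transport of [L a], so that moving
    [L b] to [F b] amounts to moving [T (L a) (F a)], which is fixed. *)
Lemma transport_continuous D (L : D -> Z) (F : D -> X) :
  continuous L -> continuous F -> (forall a, mdist (g (L a)) (F a) < d) ->
  continuous (fun a => T (L a) (F a)).
Proof.
move=> cL cF LF a A /(transport_nbhs tr); rewrite (transport_proj tr) // => Fa.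
have cgL : continuous (fun b => g (L b)).
  by apply: continuous_compf cL; exact: transport_continuous_proj.
have nL : \forall b \near a, mdist (g (L a)) (g (L b)) < d /\
    T (L a) (g (L b)) = L b by exact: cL a _ (near_transport (L a)).
have nLF : \forall b \near a, mdist (g (L a)) (F b) < d.
  by apply: near_mdist_lt (LF a); [exact: cst_continuous|exact: cF].
have nF : \forall b \near a, mdist (F a) (F b) < d.
  exact: cF a _ (near_mdist (F a) (transport_gt0 tr)).
have nA := cF _ _ Fa.
suff : \forall b \near a, A (T (L b) (F b)) by [].
near=> b.
have [LaLb <-] : mdist (g (L a)) (g (L b)) < d /\ T (L a) (g (L b)) = L b.
  by near: b.
have LaF : mdist (g (L a)) (F b) < d by near: b.
rewrite (transport_comp tr) // -(transport_comp tr (LF a)) //.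
  by near: b.
by near: b.
Unshelve. all: by end_near. Qed.

(** Near a point where two lifts agree, both are the transport of their common
    value; near a point where they differ, transport back would make them
    agree. *)
Lemma lift_unique D (u v : D -> Z) : connected [set: D] ->
  continuous u -> continuous v -> (forall a, g (u a) = g (v a)) ->
  forall a b, u a = v a -> u b = v b.
Proof.
move=> Dc cu cv uv; apply: connected_locally_constant => // a.
have nu : \forall b \near a, mdist (g (u a)) (g (u b)) < d /\
    T (u a) (g (u b)) = u b by exact: cu a _ (near_transport (u a)).
have nv : \forall b \near a, mdist (g (v a)) (g (v b)) < d /\
    T (v a) (g (v b)) = v b by exact: cv a _ (near_transport (v a)).
near=> b.
have [du Eu] : mdist (g (u a)) (g (u b)) < d /\ T (u a) (g (u b)) = u b.
  by near: b.
have [_ Ev] : mdist (g (v a)) (g (v b)) < d /\ T (v a) (g (v b)) = v b.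
  by near: b.
rewrite -Eu -Ev -uv; split=> [->//|]; exact: transport_inj.
Unshelve. all: by end_near. Qed.

(** ** Transport along chains *)

Lemma foldl_transport_proj z s :
  path (fun a b => mdist a b < d) (g z) s -> g (foldl T z s) = last (g z) s.
Proof.
elim: s z => //= y s ih z /andP[zy ys].
by rewrite ih (transport_proj tr).
Qed.

(** Inserting a point in a chain replaces one step by the two other sides of a
    triangle, and [transport_comp] is the statement for triangles. *)
Lemma foldl_transport_ehom z y s t :
  ehom d (g z) y s t -> foldl T z s = foldl T z t.
Proof.
case=> c [c' [<- <-]]; elim=> [{}c {}c' m|//|{}c {}c' c'' _ -> _ -> //].
wlog : c c' {m} / adds_point (val c) (val c').
  by case: m => m H; [exact: H|exact/esym/H].
move=> [s1 [a [s2 [cE c'E]]]]; have := valP c; have := valP c'.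
rewrite cE c'E !is_eps_chain_cat => /andP[+ +] /andP[_].
move=> /andP[s1P _]; rewrite !foldl_cat /=.
have := foldl_transport_proj s1P; move: (foldl T z s1) => w <-.
rewrite is_eps_chain_cons; case: s2 {cE c'E} => [|b s2] /=.
  move=> /andP[wa /is_eps_chain_last /= aw] /is_eps_chain_last /= wy.
  by rewrite aw -wy (transport_id tr).
rewrite !is_eps_chain_cons => /andP[wa /andP[ab _]] /andP[wb _].
by rewrite (transport_comp tr).
Qed.

Lemma foldl_transport_rev z y s : is_eps_chain d (g z) y s ->
  foldl T (foldl T z s) (rev_chain (g z) s) = z.
Proof.
move=> sP; rewrite -foldl_cat.
exact: foldl_transport_ehom (ehom_catV (transport_gt0 tr) sP).
Qed.

End one_transport.
End transport_theory.


(** * Paths and the lifting of homotopies *)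

Section path_of_function.
Context {R : realType} {Z : topologicalType}.

Lemma path_of_function (c : R -> Z) (a b : Z) :
  continuous c -> c 0 = a -> c 1 = b ->
  exists p : {path unit_itv R from a to b in Z}, forall t, p t = c t.
Proof.
move=> cc c0 c1.
have cI : continuous (c : unit_itv R -> Z) by exact: continuous_subspaceT.
by exists (mk_path cI c0 c1).
Qed.

Lemma path_connected_connected (a : Z) :
  (forall b, inhabited {path unit_itv R from a to b in Z}) ->
  connected [set: Z].
Proof.
move=> pa; have p b : {c : R -> Z | continuous c & c 0 = a /\ c 1 = b}.
  apply: cid2; have [c] := pa b; exists (fun t => c (clamp t)).
    exact: path_clamp_continuous.
  by rewrite clamp0 clamp1 path0 path1.
rewrite (_ : setT = \bigcup_(b in setT) [set s2val (p b) t | t in setT]).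
  apply: bigcup_connected; last first.
    move=> b _; apply: connected_continuous_connected; last first.
      exact: continuous_subspaceT (s2valP (p b)).
    exact: connected_real.
  by exists a => b _; exists 0 => //; have [] := s2valP' (p b).
apply/seteqP; split=> // b _; exists b => //; exists 1 => //.
by have [] := s2valP' (p b).
Qed.

Lemma project_path (T : topologicalType) (g : Z -> T) (a b : Z) (a' b' : T)
    (c : {path unit_itv R from a to b in Z}) :
  continuous g -> g a = a' -> g b = b' ->
  exists f : {path unit_itv R from a' to b' in T}, (f : R -> T) = g \o c.
Proof.
move=> cg <- <-.
have cI : continuous (g \o c : unit_itv R -> T).
  by move=> t; apply: continuous_comp; [exact: cts_fun|exact: cg].
have c0 : (g \o c) (0 : R) = g a by rewrite /= path0.
have c1 : (g \o c) (1 : R) = g b by rewrite /= path1.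
by exists (mk_path cI c0 c1).
Qed.

End path_of_function.

Section lifting.
Context {R : realType} {X : metricType R} {Z : topologicalType}.
Context {g : Z -> X} {d : R} {T : Z -> X -> Z}.
Hypothesis tr : transport g d T.
Local Notation I := (unit_itv R).

(** On [[t, t']] both [c] and the transport of [c t] lift the projection of
    [c]. *)
Lemma transport_along (c : R -> Z) (t t' : R) :
  continuous (fun u => c (clamp u)) -> 0 <= t -> t <= t' -> t' <= 1 ->
  (forall u, t <= u <= t' -> mdist (g (c t)) (g (c u)) < d) ->
  T (c t) (g (c t')) = c t'.
Proof.
move=> cc t0 tt' t'1 near.
(* The projection of the line onto the segment from t to t'. *)
pose w u := Num.max t (Num.min t' u).
have wP u : t <= w u <= t'.
  by rewrite /w le_max lexx ge_max tt' ge_min lexx.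
have cw : continuous w.
  apply: continuous_maxf; first exact: continuous_cstf.
  by apply: continuous_minf; [exact: continuous_cstf|exact: continuous_idf].
have wE u : clamp (w u) = w u.
  by apply: clampE; rewrite in_itv /=; have /andP[] := wP u; lra.
have ccw : continuous (fun u => c (w u)).
  by rewrite (_ : (fun _ => _) = fun u => c (clamp (w u)));
    [exact: continuous_compf cc cw|apply/funext => u; rewrite wE].
have cgw : continuous (fun u => g (c (w u))).
  exact: continuous_compf (transport_continuous_proj tr) ccw.
have wt : w t = t by rewrite /w min_r // max_l.
have wt' : w t' = t' by rewrite /w min_l // max_r.
rewrite -wt'; apply: (lift_unique tr (@connected_real R)
  (u := fun u => T (c t) (g (c (w u)))) (v := fun u => c (w u)) _ ccw _ (a := t)).
- apply: (transport_continuous tr) => //; first exact: continuous_cstf.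
  by move=> u; exact/near/wP.
- by move=> u; rewrite (transport_proj tr) //; exact/near/wP.
- by rewrite wt (transport_id tr).
Qed.

(** The map [c] is the lift of its projection, and each strong step of the
    projection stays in a ball over which lifts are given by transport. *)
Lemma foldl_transport_path (z z' : Z) (c : {path I from z to z' in Z}) s :
  strong_chain d (g \o c) s -> foldl T z (map (g \o c) s) = z'.
Proof.
move=> [[sP /eqP sl] ss].
suff along a : 0 <= a -> last a s <= 1 -> path <%O a s ->
    path (strong_step d (g \o c)) a s ->
    foldl T (c a) (map (g \o c) s) = c (last a s).
  by have := along 0; rewrite sl path0 path1; apply.
elim: s a {sP sl ss} => //= b s ih a a0 l1 /andP[ab bs] /andP[sab sbs].
have b1 : b <= 1.
  by apply: le_trans l1; apply: (lt_path_le_last bs); rewrite mem_head.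
rewrite transport_along ?ih ?(ltW ab) ?(le_trans a0 (ltW ab)) //.
  exact: path_clamp_continuous.
by move=> u /(strong_stepP _ _ _ _ sab)[+ _]; rewrite metric_sym.
Qed.

Lemma foldl_transport_continuous (D : topologicalType) (F : nat -> D -> X)
    (L : D -> Z) (s : seq nat) :
  continuous L -> (forall i, continuous (F i)) ->
  (forall a, path (fun x y => mdist x y < d) (g (L a)) [seq F i a | i <- s]) ->
  continuous (fun a => foldl T (L a) [seq F i a | i <- s]).
Proof.
move=> + cF; elim: s L => //= i s ih L cL LF.
apply: ih => [|a].
  by apply: (transport_continuous tr) => // a; have /andP[] := LF a.
by have /andP[? ?] := LF a; rewrite (transport_proj tr).
Qed.

(** The value of the lift at [p] is obtained by transport along a subdivision
    of the segment from the origin to [p].  Uniform continuity of [H] lets the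
    number of points of the subdivision be independent of [p], and then
    continuity in [p] is that of transport. *)
Lemma lift_square (H : R * R -> X) (z : Z) :
  continuous H -> g z = H (0, 0) ->
  exists L : R * R -> Z, [/\ continuous L, L (0, 0) = z &
    forall t s, g (L (t, s)) = H (clamp t, clamp s)].
Proof.
move=> cH gz.
have cK : compact ([set` `[0 : R, 1]] `*` [set` `[0 : R, 1]]).
  by apply: compact_setX; exact: segment_compact.
have [e e0 eP] := compact_unif_continuous cK cH (transport_gt0 tr).
pose n := (Num.truncn e^-1).+1.
have n0 : 0 < n%:R :> R by rewrite ltr0n.
have ne : n%:R^-1 < e by rewrite invf_plt ?posrE //; exact: truncnS_gt.
pose q (i : nat) (t : R) := clamp t * (i%:R / n%:R).
pose F (i : nat) (p : R * R) := H (q i p.1, q i p.2).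
have cq i : continuous (q i).
  apply: continuous_mulf; last exact: continuous_cstf.
  exact: clamp_continuous.
have cF i : continuous (F i).
  apply: (continuous_compf cH); apply: continuous_pairf.
    exact: continuous_compf (cq i) (@continuous_fstf _ _).
  exact: continuous_compf (cq i) (@continuous_sndf _ _).
have F0 p : F 0%N p = g z by rewrite /F /q !mul0r !mulr0.
have q01 i t : (i <= n)%N -> q i t \in `[0, 1].
  move=> ni; have := clamp_itv t; rewrite !in_itv /= => /andP[t0 t1].
  rewrite /q mulr_ge0 ?divr_ge0 // mulr_ile1 ?divr_ge0 //.
  by rewrite ler_pdivrMr // mul1r ler_nat.
have qS i t : `|q i t - q i.+1 t| < e.
  have := clamp_itv t; rewrite in_itv /= => /andP[t0 t1].
  rewrite /q -mulrBr -mulrBl -natr1 opprD addNKr mulN1r mulrN normrN.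
  rewrite ger0_norm ?mulr_ge0 ?invr_ge0 //; apply: le_lt_trans ne.
  by rewrite ler_piMl // invr_ge0.
(* The induction is on the number m of steps left, from the k-th point on. *)
have FP p k m : (k + m = n)%N ->
    path (fun x y => mdist x y < d) (F k p) [seq F i p | i <- iota k.+1 m] /\
    last (F k p) [seq F i p | i <- iota k.+1 m] = F n p.
  elim: m k => [|m ih] k; first by rewrite addn0 => ->.
  rewrite addnS -addSn => km; have [pP lP] := ih _ km; split=> //=.
  rewrite pP andbT; have kn : (k < n)%N by rewrite -km leq_addr.
  have := eP (q k p.1, q k p.2) (q k.+1 p.1, q k.+1 p.2).
  rewrite ballEmdist; apply; first by split; apply: q01; exact: ltnW.
  by split; exact: qS.
exists (fun p => foldl T z [seq F i p | i <- iota 1 n]); split.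
- apply: foldl_transport_continuous => // [|p]; first exact: continuous_cstf.
  by have [] := FP p 0%N n (add0n n); rewrite F0.
- have : forall i, F i (0, 0) = g z.
    by move=> i; rewrite /F /q clamp0 !mul0r gz.
  elim: (iota 1 n) => //= i s ih Fz.
  by rewrite Fz (transport_id tr) ih.
- move=> t s; have [pP lP] := FP (t, s) 0%N n (add0n n); rewrite F0 in pP lP.
  by rewrite (foldl_transport_proj tr) // lP /F /q /= divff ?mulr1 // gt_eqF.
Qed.

Lemma lift_path (x y : X) (f : {path I from x to y in X}) (z : Z) :
  g z = x -> exists z' (c : {path I from z to z' in Z}),
    forall t, t \in `[0, 1] -> g (c t) = f t.
Proof.
move=> gz; have [||L [cL L0 LP]] := @lift_square (fun p => f (clamp p.1)) z.
- apply: (continuous_compf (@path_clamp_continuous _ _ _ _ f)).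
  exact: continuous_fstf.
- by rewrite clamp0 path0.
have cc : continuous (fun t => L (t, 0)).
  apply: (continuous_compf cL); apply: continuous_pairf.
    exact: continuous_idf.
  exact: continuous_cstf.
have [c cE] := path_of_function cc L0 erefl; exists (L (1, 0)), c => t t01.
by rewrite cE LP /= !clampE.
Qed.

(** The lift of a null-homotopy of the projection is a null-homotopy: by
    uniqueness of lifts it is [c] on one side of the square and constant on the
    three others. *)
Lemma lift_homotopic_cst (z : Z) (x : X) (c : {path I from z to z in Z})
    (f : {path I from x to x in X}) :
  (forall t, t \in `[0, 1] -> g (c t) = f t) ->
  homotopic f (cst x) -> homotopic c (cst z).
Proof.
move=> cf /homotopicP[H [cH H0 H1 Hs]].
have i0 : (0 : R) \in `[0, 1] by rewrite in_itv /= lexx ler01.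
have i1 : (1 : R) \in `[0, 1] by rewrite in_itv /= lexx ler01.
have gz : g z = x by rewrite -(@path0 _ _ _ _ c) cf // path0.
have [|L [cL L0 LP]] := @lift_square H z cH; first by rewrite H0 // path0.
have ct s : continuous (fun t => L (t, s)).
  apply: (continuous_compf cL); apply: continuous_pairf.
    exact: continuous_idf.
  exact: continuous_cstf.
have cs t : continuous (fun s => L (t, s)).
  apply: (continuous_compf cL); apply: continuous_pairf.
    exact: continuous_cstf.
  exact: continuous_idf.
have Lc t : t \in `[0, 1] -> L (t, 0) = c t.
  move=> t01; rewrite -[in RHS](clampE t01).
  apply: (lift_unique tr (@connected_real R) (ct 0)
    (@path_clamp_continuous _ _ _ _ c) _ (a := 0)).
    by move=> u; rewrite LP clamp0 H0 ?cf // clamp_itv.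
  by rewrite L0 clamp0 path0.
have Lcst (v : R -> Z) : continuous v -> v 0 = z ->
    (forall u, g (v u) = x) -> forall u, v u = z.
  move=> cv v0 gv u.
  apply: (lift_unique tr (@connected_real R) cv _ _ (a := 0)) => //.
    exact: continuous_cstf.
  by move=> w; rewrite gv.
have L0s s : L (0, s) = z.
  apply: (Lcst _ (cs 0)) => // u.
  by rewrite LP clamp0; have [] := Hs _ (clamp_itv u).
apply/homotopicP; exists L; split=> // [t t01|s s01].
  apply: (Lcst _ (ct 1)) => // u.
  by rewrite LP clamp1 H1 ?clamp_itv.
split=> //; apply: (Lcst _ (cs 1)); first by rewrite Lc // path1.
by move=> u; rewrite LP clamp1; have [] := Hs _ (clamp_itv u).
Qed.

End lifting.


(** * Coverings from transports *)

Section sheets.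
Context {R : realType} {X : metricType R} {Z : topologicalType}.
Context {g : Z -> X} {d : R} {T : Z -> X -> Z}.
Hypothesis tr : transport g d T.

Lemma transport_continuous_at z y :
  mdist (g z) y < d -> {for y, continuous (T z)}.
Proof.
move=> zy A /(transport_nbhs tr); rewrite (transport_proj tr) // => yA.
suff : \forall y' \near y, A (T z y') by [].
near=> y'; rewrite -(@transport_comp _ _ _ _ _ _ tr z y) //.
- by near: y'.
- by near: y'; exact: near_mdist_lt (@cst_continuous _ _ _ _) _ zy.
- by near: y'; exact: near_mdist (transport_gt0 tr).
Unshelve. all: by end_near. Qed.

Definition sheet (z : Z) : set Z :=
  [set w | mdist (g z) (g w) < d /\ T z (g w) = w].

Lemma open_sheet z : open (sheet z).
Proof.
rewrite openE => w [zw zwE]; apply/(transport_nbhs tr).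
near=> y; have wy : mdist (g w) y < d.
  by near: y; exact: near_mdist (transport_gt0 tr).
have zy : mdist (g z) y < d.
  by near: y; exact: near_mdist_lt (@cst_continuous _ _ _ _) _ zw.
by rewrite /sheet /= (transport_proj tr) // -zwE (transport_comp tr).
Unshelve. all: by end_near. Qed.

End sheets.

Lemma foldl_transport_morphism (R : realType) (X : metricType R)
    (Y Z : topologicalType) (f : Y -> X) (d : R) (T : Y -> X -> Y)
    (T' : Z -> X -> Z) (h : Y -> Z) : transport f d T ->
  (forall w y, mdist (f w) y < d -> h (T w y) = T' (h w) y) ->
  forall w s, path (fun a b => mdist a b < d) (f w) s ->
  h (foldl T w s) = foldl T' (h w) s.
Proof.
move=> tr hT w s; elim: s w => //= y s ih w /andP[wy ys].
by rewrite ih ?(transport_proj tr) // hT.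
Qed.

(** The sheets of [h] over the sheet of [z] are the sheets of the points of the
    fibre of [z]: both kinds of sheets project bijectively to the same ball. *)
Lemma cover_of_transport (R : realType) (X : metricType R)
    (Y Z : topologicalType) (f : Y -> X) (g : Z -> X) (d : R)
    (T : Y -> X -> Y) (T' : Z -> X -> Z) (h : Y -> Z) :
  transport f d T -> transport g d T' ->
  (forall w, g (h w) = f w) ->
  (forall w y, mdist (f w) y < d -> h (T w y) = T' (h w) y) ->
  connected [set: Y] -> connected [set: Z] -> inhabited Y -> is_cover h.
Proof.
move=> tr tr' gh hT Yc Zc [w0].
have ch : continuous h.
  move=> w A /(transport_nbhs tr') wA; apply/(transport_nbhs tr).
  rewrite gh in wA; near=> y; rewrite /= hT; first by near: y.
  by near: y; exact: near_mdist (transport_gt0 tr).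
split=> // z.
  apply: (@connected_locally_constant _ (fun z => exists w, h w = z) Zc _ (h w0));
    last by exists w0.
  move=> {}z; apply: filterS (near_transport tr' z) => z' [zz' zE].
  split=> -[w wE]; [exists (T w (g z'))|exists (T w (g z))].
    by rewrite hT -?gh wE.
  rewrite hT -?gh wE; last by rewrite metric_sym.
  by rewrite -zE (transportK tr').
exists (@sheet _ _ _ g d T' z); split; first exact: (open_sheet tr').
  by split; rewrite ?mdistxx ?(transport_id tr') ?(transport_gt0 tr').
have sheet_map w : h w = z ->
    forall v, @sheet _ _ _ f d T w v -> @sheet _ _ _ g d T' z (h v).
  by move=> <- v [wv vE]; split; rewrite !gh // -hT // vE.
exists [set @sheet _ _ _ f d T w | w in h @^-1` [set z]]; split.
- move=> _ _ [w1 w1z <-] [w2 w2z <-] [v [[wv1 v1] [_ v2]]].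
  congr sheet; apply: (transport_inj tr) wv1 _; last by rewrite v1 v2.
  by rewrite -!gh w1z w2z.
- apply/seteqP; split=> [v [zv vE]|v [_ [w wz <-]]]; last exact: sheet_map.
  have vz : mdist (f v) (g z) < d by rewrite metric_sym -gh.
  have wz : h (T v (g z)) = z.
    by rewrite hT // -vE (transportK tr').
  exists (sheet (g := f) (d := d) (T := T) (T v (g z))); first by exists (T v (g z)).
  split; last by rewrite (transportK tr).
  by rewrite (transport_proj tr) // -gh.
- move=> _ [w wz <-]; split; first exact: (open_sheet tr).
  have fw : f w = g z by rewrite -gh wz.
  split.
  + split; first by move=> v; exact: sheet_map.
      move=> v v' /set_mem [_ vE] /set_mem [_ v'E] e.
      by rewrite -vE -v'E -!gh e.
    move=> u [zu uE]; have wu : mdist (f w) (g u) < d by rewrite fw.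
    exists (T w (g u)); last by rewrite hT // wz.
    by split; rewrite (transport_proj tr).
  + exact: continuous_subspaceT.
  + exists (fun u => T w (g u)).
      by move=> v /set_mem [wv vE]; rewrite gh.
    apply/subspace_continuousP => u [zu uE]; apply: cvg_within_filter.
    apply: continuous_comp; first exact: (transport_continuous_proj tr').
    by apply: (transport_continuous_at tr); rewrite fw.
Unshelve. all: by end_near. Qed.

(** * Geodesic spaces *)

(** The form in which geodesics are used: a ball contains a path from its center
    to each of its points. *)
Definition paths_in_balls (R : realType) (X : metricType R) : Prop :=
  forall x y : X, exists f : {path unit_itv R from x to y in X},
    forall t, t \in `[0, 1] -> mdist x (f t) <= mdist x y.

(** The partition at [t] alone shows that [f t] is at distance at most the
    length of [f] from [x]. *)
Lemma geodesic_paths_in_balls (R : realType) (X : metricType R) :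
  geodesic X -> paths_in_balls X.
Proof.
move=> gX x y; have [f fl] := gX x y; exists f => t.
rewrite in_itv /= => /andP[].
rewrite le_eqVlt => /predU1P[<- _|t0]; first by rewrite path0 mdistxx mdist_ge0.
rewrite le_eqVlt => /predU1P[->|t1]; first by rewrite path1.
have : ((mdist x (f t) + mdist (f t) y)%:E <= curve_length f)%E.
  apply: ereal_sup_ubound; exists [:: t; 1].
    by split => //=; rewrite t0 t1.
  by rewrite !big_ord_recl big_ord0 /= addr0 path0 path1.
by rewrite fl lee_fin; apply: le_trans; rewrite lerDl mdist_ge0.
Qed.

Section paths_in_balls.
Context {R : realType} {X : metricType R}.
Hypothesis pX : paths_in_balls X.
Local Notation I := (unit_itv R).

Lemma paths_in_balls_connected (x : X) : connected [set: X].
Proof.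
apply: (@path_connected_connected R _ x) => y.
by have [f _] := pX x y; constructor.
Qed.

(** ** A covering of a compact space has a transport *)

(** Used with [P] the property of being evenly covered. *)
Lemma lebesgue_number (P : set X -> Prop) : compact [set: X] ->
  (forall x, exists U, [/\ open U, U x & P U]) ->
  exists2 e : R, 0 < e & forall x, exists U, [/\ open U, P U &
    forall y, mdist x y < e -> U y].
Proof.
move=> /compact_near_coveringP cX PX.
have : \forall e \near 0^'+, [set: X] `<=` [set x | exists U, [/\ open U, P U &
    forall y, mdist x y < e -> U y]].
  apply: (cX R _ (fun e x => exists U, [/\ open U, P U &
    forall y, mdist x y < e -> U y])).
  move=> x _; have [U [oU Ux PU]] := PX x.
  have /nbhs_ballP[r /= r0 rU] : nbhs x U by exact: open_nbhs_nbhs.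
  have r2 : 0 < r / 2 by rewrite divr_gt0.
  near=> y e; exists U; split=> // z yz; apply: rU; rewrite ballEmdist /=.
  have xy : mdist x y < r / 2 by near: y; exact: near_mdist.
  have er : e < r / 2 by near: e; exact: nbhs_right_lt.
  have := metric_triangle x y z; move: xy er yz; rewrite /=; lra.
case/(filterI (nbhs_right_gt (0 : R)))/filter_ex => e [/= e0 eP].
by exists e => // x; exact: eP.
Unshelve. all: by end_near. Qed.

(** The last property says that a path in the preimage of the ball stays in the
    sheet of [z]. *)
Record local_section (Z : topologicalType) (g : Z -> X) (e : R) (z : Z)
    (s : X -> Z) : Prop := LocalSection {
  section_base : s (g z) = z;
  section_proj : forall y, mdist (g z) y < e -> g (s y) = y;
  section_continuous : forall y, mdist (g z) y < e -> {for y, continuous s};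
  section_near : \forall w \near z, s (g w) = w;
  section_path : forall c : R -> Z, continuous c -> c 0 = z ->
    (forall t, mdist (g z) (g (c t)) < e) -> forall t, s (g (c t)) = c t }.

Lemma evenly_covered_section (Z : topologicalType) (g : Z -> X) (e : R) (z : Z)
    (U : set X) : 0 < e -> open U -> evenly_covered g U ->
  (forall y, mdist (g z) y < e -> U y) -> exists s, local_section g e z s.
Proof.
move=> e0 oU [F [triv gU FP]] eU.
have Uz : U (g z) by apply: eU; rewrite mdistxx.
have [V FV Vz] : (\bigcup_(V in F) V) z by rewrite -gU.
have [oV [[VU _ VS] _ [s sg cs]]] := FP _ FV.
have gs y : U y -> g (s y) = y.
  by move=> /VS[w Vw <-]; rewrite sg // inE.
exists s; split=> [|y /eU/gs//|y /eU Uy A sA||c cc c0 cU t].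
- by rewrite sg // inE.
- have sA' : \forall y' \near y, U y' -> A (s y').
    exact: (subspace_continuousP _ _).1 cs y Uy A sA.
  have Uy' : nbhs y U by exact: open_nbhs_nbhs.
  suff : \forall y' \near y, A (s y') by [].
  by apply: filterS (filterI sA' Uy') => y' [+ Uy'y]; apply.
- have : nbhs z V by exact: open_nbhs_nbhs.
  by apply: filterS => w Vw; rewrite sg // inE.
- suff Vc : V (c t) by rewrite sg // inE.
  apply: (@connected_locally_constant R (fun t => V (c t)) (@connected_real R) _ 0);
    last by rewrite c0.
  move=> u; have [V' FV' V'u] : (\bigcup_(V in F) V) (c u).
    by rewrite -gU; exact: eU.
  have [oV' _] := FP _ FV'.
  have V'c : nbhs u (fun u' => V' (c u')).
    by apply: cc; exact: open_nbhs_nbhs.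
  apply: filterS V'c => u' V'u'.
  by split=> Vu; rewrite (triv V V') //; eexists; split; [exact: Vu| |exact: Vu|].
Qed.

(** With [e] a Lebesgue number, [transport_comp] holds for [d = e / 2] because
    a path from [y] to [y'] in the ball about [y] lies in the domains of the
    sections at [z] and at [T z y]. *)
Lemma transport_of_cover (Z : topologicalType) (g : Z -> X) :
  compact [set: X] -> is_cover g -> exists d T, transport g d T.
Proof.
move=> cX [_ cg _ ev]; have [e e0 eP] := lebesgue_number cX ev.
have [T Ts] : {T & forall z, local_section g e z (T z)}.
  apply: (@choice _ _ (fun z s => local_section g e z s)) => z.
  have [U [oU evU eU]] := eP (g z).
  exact: evenly_covered_section eU.
exists (e / 2), T; split.
- by rewrite divr_gt0.
- by move=> z y zy; apply: (section_proj (Ts z)); lra.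
- by move=> z; exact: section_base (Ts z).
- move=> z y y' zy zy' yy'.
  have [f fy] := pX y y'.
  have near_y t : mdist y (f (clamp t)) < e / 2.
    by apply: le_lt_trans yy'; exact/fy/clamp_itv.
  have near_z t : mdist (g z) (f (clamp t)) < e.
    by have := metric_triangle (g z) y (f (clamp t)); have := near_y t; lra.
  have gT t : g (T z (f (clamp t))) = f (clamp t).
    exact: (section_proj (Ts z)).
  have cT : continuous (fun t => T z (f (clamp t))).
    move=> t; apply: continuous_comp; first exact: path_clamp_continuous.
    exact: (section_continuous (Ts z)).
  have := section_path (Ts (T z y)) cT _ _ 1.
  rewrite gT clamp1 path1; apply; first by rewrite clamp0 path0.
  move=> t; rewrite gT (section_proj (Ts z)); last by lra.
  by have := near_y t; lra.
- move=> z A; split=> [zA|zA].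
    have gz : mdist (g z) (g z) < e by rewrite mdistxx.
    by apply: (section_continuous (Ts z) gz); rewrite (section_base (Ts z)).
  by apply: filterS (filterI (section_near (Ts z)) (cg z _ zA)) => w /= [->].
Qed.

(** ** Transport and paths in balls *)

Lemma transport_path_ex (Z : topologicalType) (g : Z -> X) (d : R)
    (T : Z -> X -> Z) (z : Z) (y : X) :
  transport g d T -> mdist (g z) y < d ->
  inhabited {path I from z to T z y in Z}.
Proof.
move=> tr zy; have [f fP] := pX (g z) y.
have cT : continuous (fun t => T z (f (clamp t))).
  apply: (transport_continuous tr).
  - exact: continuous_cstf.
  - exact: path_clamp_continuous.
  - by move=> t; apply: le_lt_trans zy; exact/fP/clamp_itv.
have [||p _] := path_of_function (a := z) (b := T z y) cT.
- by rewrite clamp0 path0 (transport_id tr).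
- by rewrite clamp1 path1.
- by constructor.
Qed.

(** A continuous map over [X] commutes with transport: along a path in the ball
    it produces a second lift, and lifts are unique. *)
Lemma transport_morphism (Y Z : topologicalType) (f : Y -> X) (g : Z -> X)
    (d : R) (T : Y -> X -> Y) (T' : Z -> X -> Z) (h : Y -> Z) :
  transport f d T -> transport g d T' -> continuous h ->
  (forall w, g (h w) = f w) ->
  forall w y, mdist (f w) y < d -> h (T w y) = T' (h w) y.
Proof.
move=> tr tr' ch gh w y wy; have [p pP] := pX (f w) y.
have near_w t : mdist (f w) (p (clamp t)) < d.
  by apply: le_lt_trans wy; exact/pP/clamp_itv.
have cp := @path_clamp_continuous _ _ _ _ p.
have := @lift_unique _ _ _ _ _ _ tr' _ (fun t => h (T w (p (clamp t))))
  (fun t => T' (h w) (p (clamp t))) (@connected_real R) _ _ _ 0 1.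
rewrite clamp1 path1; apply.
- apply: (continuous_compf ch); apply: (transport_continuous tr) => //.
  exact: continuous_cstf.
- apply: (transport_continuous tr') => //; first exact: continuous_cstf.
  by move=> t; rewrite gh.
- by move=> t; rewrite gh (transport_proj tr) ?(transport_proj tr') ?gh.
- by rewrite clamp0 path0 (transport_id tr) -gh (transport_id tr').
Qed.

End paths_in_balls.


(** * The space of classes of chains *)

Section chain_space.
Context {R : realType} {X : metricType R}.
Variables (eps : R) (x : X).
Implicit Types (s t : seq X) (y : X).

Definition is_chain s := path (fun a b => mdist a b < eps) x s.

Definition based_chain := {s : seq X | is_chain s}.

Definition base_chain : based_chain := exist _ [::] isT.

Let chain_rel (c c' : based_chain) : bool :=
  `[< ehom eps x (last x (val c)) (val c) (val c') >].

Lemma is_chainE s : is_eps_chain eps x (last x s) s = is_chain s.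
Proof. by rewrite /is_eps_chain eqxx andbT. Qed.

Lemma ehom_last y s t : ehom eps x y s t -> y = last x s /\ y = last x t.
Proof. by move=> /ehom_valid[/is_eps_chain_last -> /is_eps_chain_last ->]. Qed.

Let chain_rel_refl : reflexive chain_rel.
Proof.
by move=> c; apply/asboolP/ehom_refl; rewrite is_chainE; exact: (valP c).
Qed.

Let chain_rel_sym : symmetric chain_rel.
Proof.
by move=> c c'; apply/asboolP/asboolP => /[dup] /ehom_last[_ <-] /ehom_sym.
Qed.

Let chain_rel_trans : transitive chain_rel.
Proof.
move=> c' c c'' /asboolP cc' /asboolP c'c''; apply/asboolP/(ehom_trans cc').
by have [_ ->] := ehom_last cc'.
Qed.

Definition chain_equiv :=
  EquivRel chain_rel chain_rel_refl chain_rel_sym chain_rel_trans.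

Definition chain_space : Type := {eq_quot chain_equiv}.

HB.instance Definition _ := Choice.on chain_space.
HB.instance Definition _ := EqQuotient.on chain_space.

(** A total function, to name classes by bare sequences: a sequence that is not
    a chain is sent to the class of the constant chain. *)
Definition chain_class s : chain_space := \pi_chain_space (insubd base_chain s).

Lemma chain_class_surj (e : chain_space) : exists2 s, is_chain s & e = chain_class s.
Proof.
by elim/quotW: e => c; exists (val c); [exact: (valP c)|rewrite /chain_class valKd].
Qed.

Lemma chain_class_eq s t : is_chain s -> is_chain t ->
  chain_class s = chain_class t <-> ehom eps x (last x s) s t.
Proof.
move=> sP tP; have vE u : is_chain u -> val (insubd base_chain u) = u.
  exact: insubdK.
split=> [/eqmodP/asboolP|st]; first by rewrite !vE.
by apply/eqmodP/asboolP; rewrite !vE.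
Qed.

Definition chain_end (e : chain_space) : X := last x (val (repr e)).

Lemma chain_repr (e : chain_space) : chain_class (val (repr e)) = e.
Proof. by rewrite /chain_class valKd reprK. Qed.

Lemma chain_class_end s : is_chain s -> chain_end (chain_class s) = last x s.
Proof.
move=> sP; rewrite /chain_end; set c := repr _.
have /chain_class_eq : chain_class (val c) = chain_class s by exact: chain_repr.
by move=> /(_ (valP c) sP) /ehom_last[_].
Qed.

(** Only points at distance less than [eps] from the endpoint are appended;
    elsewhere the class is left as it is, to have a total function. *)
Definition extend (e : chain_space) y : chain_space :=
  if mdist (chain_end e) y < eps then chain_class (rcons (val (repr e)) y) else e.

Lemma is_chain_rcons s y :
  is_chain (rcons s y) = is_chain s && (mdist (last x s) y < eps).
Proof. by rewrite /is_chain rcons_path. Qed.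

Lemma extend_class s y : is_chain s -> mdist (last x s) y < eps ->
  extend (chain_class s) y = chain_class (rcons s y).
Proof.
move=> sP sy; rewrite /extend chain_class_end // sy.
set c := repr _; have cP : is_chain (val c) := valP c.
have cE : chain_end (chain_class s) = last x (val c) by [].
rewrite chain_class_end // in cE.
apply/chain_class_eq; rewrite ?is_chain_rcons ?cP ?sP -?cE ?sy //.
rewrite -!cats1 last_cat /=; apply: (@ehom_cat _ _ _ _ (last x s)).
  by rewrite cE; apply/chain_class_eq => //; exact: chain_repr.
by apply: ehom_refl; rewrite /is_eps_chain /= sy eqxx.
Qed.

(** The topology in which the balls about the endpoint of a class parametrize
    its neighbourhoods; this makes appending a point a transport. *)
Definition chain_open (A : set chain_space) : Prop :=
  forall e, A e -> \forall y \near chain_end e, A (extend e y).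

Let chain_openT : chain_open setT.
Proof. by move=> e _; exact: filterT. Qed.

Let chain_openI : setI_closed chain_open.
Proof. by move=> A B oA oB e [/oA Ae /oB Be]; exact: filterI. Qed.

Let chain_open_bigU (J : Type) (A : J -> set chain_space) :
  (forall j, chain_open (A j)) -> chain_open (\bigcup_j A j).
Proof.
by move=> oA e [j _ /oA]; apply: filterS => y Ay; exists j.
Qed.

HB.instance Definition _ := isOpenTopological.Build chain_space
  chain_openT chain_openI chain_open_bigU.

Hypothesis eps0 : 0 < eps.

(** The cocycle condition holds because appending [y] and then [y'] instead of
    [y'] alone is a basic move. *)
Lemma transport_extend : transport chain_end eps extend.
Proof.
have proj e y : mdist (chain_end e) y < eps -> chain_end (extend e y) = y.
  have [s sP ->] := chain_class_surj e; rewrite chain_class_end // => sy.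
  by rewrite extend_class // chain_class_end ?last_rcons // is_chain_rcons sP.
have id e : extend e (chain_end e) = e.
  have [s sP ->] := chain_class_surj e; rewrite chain_class_end //.
  have ss : mdist (last x s) (last x s) < eps by rewrite mdistxx.
  have ssP : is_chain (rcons s (last x s)) by rewrite is_chain_rcons sP.
  rewrite extend_class //; apply/chain_class_eq => //; rewrite last_rcons.
  apply: ehom_sym; rewrite -{2}(cats0 s) -cats1; apply: ehom_add.
    by rewrite cats0 is_chainE.
  by rewrite cats1 -[X in is_eps_chain _ _ X](last_rcons x s) is_chainE.
have comp e y y' : mdist (chain_end e) y < eps -> mdist (chain_end e) y' < eps ->
    mdist y y' < eps -> extend (extend e y) y' = extend e y'.
  have [s sP ->] := chain_class_surj e; rewrite chain_class_end // => sy sy' yy'.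
  have sycP : is_chain (rcons s y) by rewrite is_chain_rcons sP.
  have sy'cP : is_chain (rcons s y') by rewrite is_chain_rcons sP.
  have syy'cP : is_chain (rcons (rcons s y) y').
    by rewrite is_chain_rcons sycP last_rcons.
  rewrite !extend_class ?last_rcons //; apply/chain_class_eq => //.
  rewrite last_rcons; apply: ehom_sym.
  rewrite -!cats1 -catA; apply: ehom_add.
    by rewrite cats1 -[X in is_eps_chain _ _ X](last_rcons x s) is_chainE.
  have : is_eps_chain eps x y' (rcons (rcons s y) y').
    by rewrite -[X in is_eps_chain _ _ X](last_rcons x (rcons s y)) is_chainE.
  by rewrite -!cats1 -catA.
split=> // e A; split=> [|eA].
  rewrite nbhsE => -[B [oB Be] BA].
  by apply: filterS (oB _ Be) => y; exact: BA.
have /nbhs_ballP[r /= r0 rA] := eA.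
pose m := Num.min r eps; have m0 : 0 < m by rewrite lt_min r0.
have mP y : mdist (chain_end e) y < m ->
    mdist (chain_end e) y < r /\ mdist (chain_end e) y < eps.
  by rewrite lt_min => /andP[].
rewrite nbhsE; exists [set extend e y | y in [set y | mdist (chain_end e) y < m]].
  split; last by exists (chain_end e); rewrite /= ?mdistxx ?id.
  move=> _ [y ym <-]; have [_ ye] := mP _ ym; rewrite proj //.
  near=> y'; have y'm : mdist (chain_end e) y' < m.
    by near: y'; exact: near_mdist_lt (@cst_continuous _ _ _ _) _ ym.
  have [_ y'e] := mP _ y'm.
  by exists y' => //; rewrite comp //; near: y'; exact: near_mdist.
move=> _ [y ym <-]; have [yr _] := mP _ ym.
by apply: rA; rewrite ballEmdist.
Unshelve. all: by end_near. Qed.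

Lemma foldl_extend s t : is_chain (s ++ t) ->
  foldl extend (chain_class s) t = chain_class (s ++ t).
Proof.
elim: t s => [|y t ih] s; first by rewrite cats0.
rewrite -cat_rcons => /[dup] stP; rewrite {1}/is_chain cat_path => /andP[+ _].
rewrite -/(is_chain _) is_chain_rcons => /andP[sP sy].
by rewrite /= extend_class // ih.
Qed.

Lemma foldl_extend_base t : is_chain t ->
  foldl extend (chain_class [::]) t = chain_class t.
Proof. exact: (@foldl_extend [::]). Qed.

(** The chain of [e] cancels on the left, so that a loop whose transport is
    closed at one point over [x] is null-homotopic. *)
Lemma foldl_extend_loop (e : chain_space) t : chain_end e = x ->
  is_eps_chain eps x x t -> foldl extend e t = e -> ehom eps x x t [::].
Proof.
have [s sP ->] := chain_class_surj e; rewrite chain_class_end // => sx tP.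
have sP' : is_eps_chain eps x x s by rewrite -{2}sx is_chainE.
have stP : is_eps_chain eps x x (s ++ t) by rewrite is_eps_chain_cat sx sP'.
have stc : is_chain (s ++ t).
  by move: stP; rewrite /is_eps_chain => /andP[].
rewrite foldl_extend // => /chain_class_eq -/(_ stc sP).
rewrite last_cat sx (is_eps_chain_last tP) => st.
have rP := ehom_catVr eps0 sP'.
have sVP : is_eps_chain eps x x (rev_chain x s) := is_eps_chain_rev sP'.
apply: (@ehom_trans _ _ _ _ _ _ ((rev_chain x s ++ s) ++ t)).
  exact/ehom_sym/(ehom_cat rP)/ehom_refl.
apply: (ehom_trans _ rP); rewrite -catA.
exact: ehom_cat (ehom_refl sVP) st.
Qed.

Hypothesis pX : paths_in_balls X.

Lemma chain_space_path_connected (e : chain_space) :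
  inhabited {path unit_itv R from chain_class [::] to e in chain_space}.
Proof.
have [s sP ->] := chain_class_surj e; elim/last_ind: s sP => [_|s y ih].
  pose c : {path unit_itv R from chain_class [::] to chain_class [::]
    in chain_space} := cst (chain_class [::]).
  by constructor.
rewrite is_chain_rcons => /andP[sP sy]; have [c] := ih sP.
have [|c'] := @transport_path_ex _ _ pX _ _ _ _ (chain_class s) y transport_extend.
  by rewrite chain_class_end.
by rewrite extend_class // in c' *; constructor; exact: path_concat c c'.
Qed.

Lemma chain_space_connected : connected [set: chain_space].
Proof. exact: path_connected_connected chain_space_path_connected. Qed.

Lemma chain_space_cover : is_cover chain_end.
Proof.
apply: (cover_of_transport transport_extend (transport_identity eps0)) => //.
- by move=> e y ey; rewrite (transport_proj transport_extend).
- exact: chain_space_connected.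
- exact: (paths_in_balls_connected pX x).
- exact: inhabits (chain_class [::]).
Qed.

(** A path in the space of classes from the constant chain to the class of [s]
    projects to a path in [X] along which the strong chains are homotopic to
    [s]. *)
Lemma strong_chain_of_chain y s : is_eps_chain eps x y s ->
  exists (f : {path unit_itv R from x to y in X}) (t : seq R),
    strong_chain eps f t /\ ehom eps x y (map f t) s.
Proof.
move=> /andP[sP /eqP <-].
have [c] := chain_space_path_connected (chain_class s).
have tr := transport_extend.
have [||f fE] := project_path c (transport_continuous_proj tr)
  (a' := x) (b' := last x s).
- exact: chain_class_end.
- exact: chain_class_end.
have [t ft] := strong_chain_ex f eps0; exists f, t; split=> //.
have tP := strong_chain_is_eps_chain ft; rewrite fE in ft tP *.
have := foldl_transport_path tr ft; rewrite foldl_extend_base.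
  have tc : is_chain (map (chain_end \o c) t) by case/andP: tP.
  by move=> /chain_class_eq -/(_ tc sP); rewrite (is_eps_chain_last tP).
by case/andP: tP.
Qed.

End chain_space.


(** * The groups of null-homotopic chains *)

Section null_chains.
Context {R : realType} {X : metricType R}.
Implicit Types (x y : X) (eps : R).
Local Notation I := (unit_itv R).

Lemma strong_chain_widen eps eps' (c : R -> X) s :
  eps <= eps' -> strong_chain eps c s -> strong_chain eps' c s.
Proof.
move=> ee' [p ss]; split=> //; apply: sub_path ss => t t' /strong_stepP h.
apply/strong_stepP => u /h[h1 h2].
by split; [exact: lt_le_trans h1 ee'|exact: lt_le_trans h2 ee'].
Qed.

Lemma eq_strong_chain eps (c c' : R -> X) s :
  (forall t, t \in `[0, 1] -> c t = c' t) ->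
  strong_chain eps c s -> strong_chain eps c' s /\ map c s = map c' s.
Proof.
move=> cc' [[sP /eqP sl] ss].
have s01 : {in 0 :: s, forall t, t \in `[0, 1]}.
  by move=> t /(lt_path_itv sP); rewrite sl.
split; last by apply/eq_in_map => t ts; apply/cc'/s01; rewrite inE ts orbT.
split; first by split=> //; exact/eqP.
apply: (sub_in_path (P := [in `[0, 1]]) _ _ ss); last exact/allP.
move=> t t' t01 t'01 /strong_stepP h; apply/strong_stepP => u utt'.
rewrite -!cc' //; first exact: h.
by move: t01 t'01 utt'; rewrite !in_itv /=; lra.
Qed.

Lemma K_epsP eps x (f : {path I from x to x in X}) s :
  0 < eps -> strong_chain eps f s ->
  K_eps eps (\pi_(pi1 R x) f) <-> ehom eps x x (map f s) [::].
Proof.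
move=> e0 fs; pose c := EpsChain (strong_chain_is_eps_chain fs).
rewrite /K_eps /= (h_epsE (c := c) e0 fs) //.
split=> [/(pi_eps_eqP c (nil_chain _ _))/ehom_val //|ec].
exact/(pi_eps_eqP c (nil_chain _ _))/ehom_val.
Qed.

Lemma discrete_pi1CP x : discrete_space (pi1C x) <->
  exists2 eps : R, 0 < eps & forall a : pi1 R x, K_eps eps a -> a = 1%g.
Proof.
split=> [disc|[e e0 K1] U].
  have /pi1C_openP/(_ 1%g erefl)[e e0 eU] := disc [set 1%g].
  by exists e => // a Ka; apply: eU; exists a => //; rewrite mul1g.
apply/pi1C_openP => a Ua; exists e => // _ [k /K1 -> <-].
by rewrite mulg1.
Qed.

(** Preimages in the group of subsets of the quotient are unions of cosets of
    [pi_cl]. *)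
Lemma discrete_pi1C_barP x : discrete_space (pi1C_bar x) <->
  exists2 eps : R, 0 < eps & K_eps eps `<=` @pi_cl R X x.
Proof.
pose pr (a : pi1C x) : pi1C_bar x := \pi_{eq_quot (pi_cl_equiv x)} a.
have prE a b : pr a = pr b <-> @pi_cl R X x (a^-1 * b)%g.
  by split=> [/eqmodP/asboolP|ab]; [|exact/eqmodP/asboolP].
split=> [disc|[e e0 Kcl] A].
  have oA : open (pr @^-1` [set pr 1%g]) by exact: disc [set pr 1%g].
  have /pi1C_openP/(_ 1%g erefl)[e e0 eU] := oA.
  exists e => // a Ka; have : pr (1 * a)%g = pr 1%g by apply: eU; exists a.
  by rewrite mul1g => /esym/prE; rewrite invg1 mul1g.
change (open (pr @^-1` A)); apply/pi1C_openP => a Aa; exists e => //.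
move=> _ [k /Kcl kcl <-]; rewrite /preimage /= (_ : pr _ = pr a) //.
by apply/esym/prE; rewrite mulKg.
Qed.

End null_chains.

Section groupoid.
Context {R : realType} {T : topologicalType}.
Local Notation path x y := {path unit_itv R from x to y in T}.

Lemma homotopic_conj_cst (a b : T) (q : path a b) (c : path b b) :
  homotopic (path_concat q (path_concat c (path_inv q))) (cst a) ->
  homotopic c (cst b).
Proof.
move=> h.
have cq : homotopic (path_concat c (path_inv q)) (path_inv q).
  apply: homotopic_trans (homotopic_sym (concat1p _)) _.
  apply: homotopic_trans (homotopic_concat (homotopic_sym (concatVp q))
    (homotopic_refl _)) _.
  apply: homotopic_trans (homotopic_sym (concatA _ _ _)) _.
  apply: homotopic_trans (homotopic_concat (homotopic_refl _) h) _.
  exact: concatp1.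
apply: homotopic_trans (homotopic_sym (concatp1 _)) _.
apply: homotopic_trans (homotopic_concat (homotopic_refl _)
  (homotopic_sym (concatVp q))) _.
apply: homotopic_trans (concatA _ _ _) _.
apply: homotopic_trans (homotopic_concat cq (homotopic_refl _)) _.
exact: concatVp.
Qed.

End groupoid.

(** * Universal and simply connected covers *)

Section universal_cover.
Context {R : realType} {X : metricType R}.
Hypothesis pX : paths_in_balls X.
Variable x : X.
Local Notation I := (unit_itv R).

(** A loop of [K_eps d], with [d] adapted to the universal cover [Y], lifts to a
    loop of [Y], hence to a loop of every other cover, in particular of the
    spaces of classes of chains, where it is closed only if it is null. *)
Lemma universal_cover_K_eps : compact [set: X] -> has_universal_cover X ->
  exists2 d : R, 0 < d & K_eps d `<=` @pi_cl R X x.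
Proof.
move=> cX [Y [f [fc univ]]]; have [d [T tr]] := transport_of_cover pX cX fc.
have d0 := transport_gt0 tr; exists d => // a + e e0; elim/quotW: a => l Kl.
pose m := Num.min d e.
have m0 : 0 < m by rewrite lt_min d0.
have md : m <= d by rewrite ge_min lexx.
have me : m <= e by rewrite ge_min lexx orbT.
apply: (K_eps_subset m0 me).
have [s sm] := strong_chain_ex l m0.
have /(K_epsP d0) sd := strong_chain_widen md sm.
have [y0 y0x] : exists y, f y = x by have [_ _ surj _] := fc; exact: surj.
have closed : foldl T y0 (map l s) = y0.
  have := foldl_transport_ehom (z := y0) (y := x) (s := map l s) (t := [::]) tr.
  by rewrite y0x; apply; exact/sd.
have [h [[_ ch _ _] hf]] := univ _ _ (chain_space_cover x m0 pX).
have he w : chain_end (h w) = f w by rewrite -hf.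
have trm := transport_sub m0 md tr; have tre := transport_extend x m0.
have sP := strong_chain_is_eps_chain sm.
apply/(K_epsP m0 sm)/(foldl_extend_loop m0 (e := h y0)) => //.
  by rewrite he.
rewrite -(foldl_transport_morphism trm (transport_morphism pX trm tre ch he)).
  by rewrite closed.
by rewrite y0x; case/andP: sP.
Qed.

(** ** Refining chains *)

Section stable.
Variables (e d : R).
Hypotheses (e0 : 0 < e) (d0 : 0 < d) (de : d <= e).
Hypothesis Ked : K_eps e `<=` @K_eps R X x d.

(** A class of [e]-chains is the class of a strong chain along a path, and along
    this path there are also strong [d]-chains. *)
Lemma chain_class_refine (u : chain_space e x) :
  exists2 s, is_chain d x s & chain_class e x s = u.
Proof.
have [s sP ->] := chain_class_surj u.
have [|f [t [ft ts]]] := @strong_chain_of_chain _ _ _ x e0 pX (last x s) s.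
  by rewrite is_chainE.
have [t' ft'] := strong_chain_ex f d0; exists (map f t').
  by have /andP[] := strong_chain_is_eps_chain ft'.
have fe' := strong_chain_widen de ft'.
have /andP[fc /eqP fl] := strong_chain_is_eps_chain fe'.
apply/chain_class_eq => //; rewrite fl.
exact: ehom_trans (strong_chain_ehom e0 fe' ft) ts.
Qed.

(** A [d]-loop comes from a loop of [X], to which the inclusion of [K_eps e] in
    [K_eps d] applies. *)
Lemma null_chain_refine s : is_eps_chain d x x s ->
  ehom e x x s [::] -> ehom d x x s [::].
Proof.
move=> sP se; have [f [t [ft ts]]] := strong_chain_of_chain d0 pX sP.
apply: ehom_trans (ehom_sym ts) _; apply/(K_epsP d0 ft)/Ked.
apply/(K_epsP e0 (strong_chain_widen de ft)).
exact: ehom_trans (ehom_widen de ts) se.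
Qed.

Lemma ehom_refine_eps y s t : is_eps_chain d x y s -> is_eps_chain d x y t ->
  ehom e x y s t -> ehom d x y s t.
Proof.
move=> sP tP st; have rP := is_eps_chain_rev tP.
have [_ tPe] := ehom_valid st; have rPe := is_eps_chain_rev tPe.
have null : ehom d x x (s ++ rev_chain x t) [::].
  apply: null_chain_refine.
    by rewrite is_eps_chain_cat (is_eps_chain_last sP) sP.
  exact: ehom_trans (ehom_cat st (ehom_refl rPe)) (ehom_catV e0 tPe).
have := ehom_cat null (ehom_refl tP); rewrite -catA.
apply: ehom_trans; apply: ehom_sym.
by have := ehom_cat (ehom_refl sP) (ehom_catVr d0 tP); rewrite cats0.
Qed.

(** The class of a [d]-chain goes to the endpoint of the lift of that chain;
    this does not depend on the chain because two [d]-chains that are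
    [e]-homotopic are [d]-homotopic. *)
Lemma chain_space_to_cover (Z : topologicalType) (g : Z -> X)
    (T : Z -> X -> Z) : is_cover g -> transport g d T ->
  exists h : chain_space e x -> Z, is_cover h /\ g \o h = @chain_end R X e x.
Proof.
move=> [Zc _ surj _] tr; have [z0 z0x] := surj x.
have [h hP] : {h : chain_space e x -> Z & forall u, exists s,
    [/\ is_chain d x s, chain_class e x s = u & h u = foldl T z0 s]}.
  apply: (@choice _ _ (fun u z => exists s,
    [/\ is_chain d x s, chain_class e x s = u & z = foldl T z0 s])) => u.
  by have [s sP su] := chain_class_refine u; exists (foldl T z0 s), s.
have widen s : is_chain d x s -> is_chain e x s.
  by apply: sub_path => a b ab; exact: lt_le_trans ab de.
have hE s : is_chain d x s -> h (chain_class e x s) = foldl T z0 s.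
  move=> sP; have [t [tP + ->]] := hP (chain_class e x s).
  move=> /chain_class_eq -/(_ (widen _ tP) (widen _ sP)) ts.
  apply: (foldl_transport_ehom (y := last x t) tr); rewrite z0x.
  have [_ tl] := ehom_last ts.
  by apply: ehom_refine_eps ts; rewrite ?is_chainE // tl is_chainE.
have tre := transport_sub d0 de (transport_extend x e0).
have gh u : g (h u) = chain_end u.
  have [s [sP <- ->]] := hP u.
  by rewrite (foldl_transport_proj tr) z0x // chain_class_end // widen.
exists h; split; last by apply/funext.
apply: (cover_of_transport tre tr gh) => // [u y||].
- have [s [sP <- hs]] := hP u; rewrite chain_class_end ?widen // => sy.
  rewrite extend_class ?widen //; last exact: lt_le_trans sy de.
  by rewrite !hE ?is_chain_rcons ?sP // foldl_rcons.
- exact: chain_space_connected.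
- exact: inhabits (chain_class e x [::]).
Qed.

End stable.

Lemma chain_space_universal (e : R) : compact [set: X] -> 0 < e ->
  K_eps e `<=` @pi_cl R X x -> is_universal_cover (@chain_end R X e x).
Proof.
move=> cX e0 Kcl; split; first exact: chain_space_cover.
move=> Z g gc; have [d [T tr]] := transport_of_cover pX cX gc.
pose m := Num.min e d.
have m0 : 0 < m by rewrite lt_min e0 (transport_gt0 tr).
have me : m <= e by rewrite ge_min lexx.
have md : m <= d by rewrite ge_min lexx orbT.
apply: (@chain_space_to_cover e m) (transport_sub m0 md tr) => //.
by move=> a /Kcl; exact.
Qed.

(** A loop of the space of classes becomes, once joined to the base point, a
    lift of a loop of [K_eps e]. *)
Lemma chain_space_simply_connected (e : R) : 0 < e ->
  (forall a : pi1 R x, K_eps e a -> a = 1%g) ->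
  simply_connected R (chain_space e x).
Proof.
move=> e0 K1; have conn := chain_space_path_connected (x := x) e0 pX.
have tr := transport_extend x e0.
split=> [u v|u a].
  have [c] := conn u; have [c'] := conn v.
  by constructor; exact: path_concat (path_inv c) c'.
elim/quotW: a => c; apply/pi1_eqP; have [q] := conn u.
apply: (@homotopic_conj_cst _ _ _ _ q); set k := path_concat q _.
have [||f fE] := project_path k (transport_continuous_proj tr)
  (a' := x) (b' := x).
- exact: chain_class_end.
- exact: chain_class_end.
apply: (lift_homotopic_cst tr (f := f)); first by move=> t _; rewrite fE.
apply/pi1_eqP/K1; have [s fs] := strong_chain_ex f e0.
apply/(K_epsP e0 fs)/(foldl_extend_loop e0 (e := chain_class e x [::])).
- exact: chain_class_end.
- exact: strong_chain_is_eps_chain fs.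
- by rewrite fE in fs *; exact: foldl_transport_path fs.
Qed.

(** A loop of [K_eps d] lifts to a loop, and a contraction of the lift projects
    to a contraction of the loop. *)
Lemma simply_connected_cover_K_eps : compact [set: X] ->
  has_simply_connected_cover R X ->
  exists2 d : R, 0 < d & forall a : pi1 R x, K_eps d a -> a = 1%g.
Proof.
move=> cX [Y [f [fc [_ simple]]]].
have [d [T tr]] := transport_of_cover pX cX fc.
have d0 := transport_gt0 tr; exists d => // a; elim/quotW: a => l.
have [s ls] := strong_chain_ex l d0; move=> /(K_epsP d0 ls) null.
have [_ cf surj _] := fc; have [y0 y0x] := surj x.
have [y1 [c cl]] := lift_path tr l y0x.
have [|cs mapE] := eq_strong_chain (c' := f \o c) _ ls.
  by move=> t t01; rewrite /= cl.
have y1E : y0 = y1.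
  rewrite -(foldl_transport_path tr cs) -mapE.
  have := foldl_transport_ehom (z := y0) (y := x) (s := map l s) (t := [::]) tr.
  by rewrite y0x => /(_ null) ->.
case: y1 / y1E in c cl cs mapE.
have /pi1_eqP/homotopicP[H [cH H0 H1 Hs]] :
  \pi_(pi1 R y0) c = \pi_(pi1 R y0) (cst y0) by exact: simple.
apply/pi1_eqP/homotopicP; exists (f \o H); split=> [|t t01|t t01|t t01] /=.
- exact: continuous_compf cf cH.
- by rewrite H0 ?cl.
- by rewrite H1.
- by have [-> ->] := Hs t t01.
Qed.

End universal_cover.

Theorem theorem1p3 (R : realType) (X : metricType R) (x : X) :
  compact [set: X] -> geodesic X ->
  (has_universal_cover X <-> discrete_space (pi1C_bar x)) /\
  (has_simply_connected_cover R X <-> discrete_space (pi1C x)).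
Proof.
move=> cX /geodesic_paths_in_balls pX; split; split.
- by move=> uc; apply/discrete_pi1C_barP; exact: universal_cover_K_eps.
- move=> /discrete_pi1C_barP[e e0 Kcl].
  by exists (chain_space e x), (@chain_end R X e x); exact: chain_space_universal.
- by move=> sc; apply/discrete_pi1CP; exact: simply_connected_cover_K_eps.
- move=> /discrete_pi1CP[e e0 K1]; exists (chain_space e x), (@chain_end R X e x).
  split; first exact: chain_space_cover.
  exact: chain_space_simply_connected.
Qed.
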